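(* Let $p(\cdot)\in\mathcal{P}$ with $p(\cdot)\in LH$ and let $w\in\mathcal{A}_{p(\cdot),\infty}$. Then $\mathbb{W}:=[w(\cdot)]^{p(\cdot)}\in A_\infty$, and there exist positive constants $C$ and $A$, depending only on $p(\cdot)$ and $n$, such that, for any cube $Q$ in $\mathbb{R}^n$ and any measurable set $E\subset Q$ with $|E|>(1-\alpha)|Q|$, $$\mathbb{W}(Q)<C\left(1-2\alpha^{1-\frac1\delta}\right)^{-p_+}[w]_{\mathcal{A}_{p(\cdot),\infty}}^{A}L_w\,\mathbb{W}(E),$$ where $\delta:=1+\frac{1}{\tau_nC_{p(\cdot),n}[w]_{\mathcal{A}_{p(\cdot),\infty}}}$, $\alpha\in(0,2^{-\frac{\delta}{\delta-1}})$ is any given constant, and $$L_w:=\max\left\{\|w\mathbf{1}_{Q_0}\|_{L^{p(\cdot)}}^{p_--p_+},\ \|w\mathbf{1}_{Q_0}\|_{L^{p(\cdot)}}^{p_+-p_-}\right\}.$$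
   Context: Everything is on $\mathbb{R}^n$. $\mathcal{P}$ is the set of measurable $p:\mathbb{R}^n\to[1,\infty]$; $p_-$ and $p_+$ are the essential infimum and supremum of $p$ over $\mathbb{R}^n$. A measurable real-valued function $r$ on $\mathbb{R}^n$ belongs to $LH$ if there is $C_0>0$ with $|r(x)-r(y)|\le -\frac{C_0}{\log|x-y|}$ whenever $|x-y|<\frac12$, and there are positive constants $r_\infty,C_\infty$ with $|r(x)-r_\infty|\le\frac{C_\infty}{\log(e+|x|)}$ for all $x$. A constant ''depends only on $p(\cdot)$'' if it depends only on $p_-,p_+,p_\infty,C_0,C_\infty$. For a measurable function $f$, $\|f\|_{L^{p(\cdot)}}:=\inf\{\lambda>0:\int_{\mathbb{R}^n}|f(x)/\lambda|^{p(x)}\,dx\le1\}$ (with $\inf\emptyset=\infty$). Cubes have finite positive edge length and edges parallel to the axes (not necessarily open or closed); $\fint_Q$ denotes the average $\frac1{|Q|}\int_Q$; $Q_0$ is the cube centered at the origin with edge length $2e$. For a measurable set $E$, $\mathbb{W}(E):=\int_E\mathbb{W}(x)\,dx$. A scalar weight is a non-negative measurable function on $\mathbb{R}^n$ that is positive almost everywhere; $w\in\mathcal{A}_{p(\cdot),\infty}$ means $$[w]_{\mathcal{A}_{p(\cdot),\infty}}:=\sup_Q\frac{1}{\|\mathbf{1}_Q\|_{L^{p(\cdot)}}}\|w\mathbf{1}_Q\|_{L^{p(\cdot)}}\exp\left(\fint_Q\log(w^{-1}(y))\,dy\right)<\infty,$$ and $v\in A_\infty$ means $[v]_{A_\infty}:=\sup_Q\fint_Qv(x)\,dx\,\exp\left(\fint_Q\log(v^{-1}(x))\,dx\right)<\infty$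 (suprema over all cubes; a product $\infty\cdot0$ is understood as $\infty$). The constant $C_{p(\cdot),n}$ is a fixed positive constant, depending only on $p(\cdot)$ and $n$, such that $\fint_Q|f(x)|\,dx\le C_{p(\cdot),n}\frac{1}{\|\mathbf{1}_Q\|_{L^{p(\cdot)}}}\|f\mathbf{1}_Q\|_{L^{p(\cdot)}}$ for every measurable $f$ and every cube $Q$. The constant $\tau_n$ is a fixed positive constant, depending only on $n$, such that for every $v\in A_\infty$, every $r\in[1,1+\frac{1}{\tau_n[v]_{A_\infty}}]$ and every cube $Q$, $\left[\fint_Qv^r(x)\,dx\right]^{1/r}\le2\fint_Qv(x)\,dx$ (such constants are known to exist). *)

(* Defs.v *)
From HB Require Import structures.
From mathcomp Require Import all_boot all_order all_algebra.
From mathcomp Require Import all_classical all_reals all_analysis.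
From mathcomp Require Import measurable_realfun ess_sup_inf.

Set Implicit Arguments.
Unset Strict Implicit.
Unset Printing Implicit Defensive.

Import Order.TTheory GRing.Theory Num.Theory.
Import numFieldNormedType.Exports.

Local Open Scope classical_set_scope.
Local Open Scope ring_scope.
Local Open Scope ereal_scope.

(* Lebesgue measure on R^n: the n-fold product of the library's Borel measure
   [lebesgue_measure] on R, transported along the bijection
   R * R^n -> R^(n+1), and then completed, so that "measurable" on [Rn R n]
   means Lebesgue measurable. *)
Section borel_lebesgue_step.
Context {R : realType} (n : nat).

Definition cons_tuple (z : R * n.-tuple R) : n.+1.-tuple R :=
  [the n.+1.-tuple R of z.1 :: z.2].

Lemma measurable_cons_tuple : measurable_fun [set: R * n.-tuple R] cons_tuple.
Proof. exact: measurable_cons. Qed.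

Variable m : {sigma_finite_measure set (n.-tuple R) -> \bar R}.

Definition borel_lebesgue_step : set (n.+1.-tuple R) -> \bar R :=
  pushforward (lebesgue_measure \x m) cons_tuple.

Let step0 : borel_lebesgue_step set0 = 0.
Proof. by rewrite /borel_lebesgue_step /pushforward preimage_set0 measure0. Qed.

Let step_ge0 A : 0 <= borel_lebesgue_step A.
Proof. by rewrite /borel_lebesgue_step /pushforward; exact: measure_ge0. Qed.

Let step_sigma_additive : semi_sigma_additive borel_lebesgue_step.
Proof.
move=> F mF tF mUF; rewrite /borel_lebesgue_step /pushforward preimage_bigcup.
have mpre (A : set (n.+1.-tuple R)) : measurable A ->
    measurable (cons_tuple @^-1` A).
  by move=> mA; rewrite -[X in measurable X]setTI; exact: measurable_cons_tuple.
apply: measure_semi_sigma_additive.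
- by move=> i; exact: mpre.
- apply/trivIsetP => /= i j _ _ ij; rewrite -preimage_setI.
  by move/trivIsetP : tF => /(_ _ _ _ _ ij) ->//; rewrite preimage_set0.
- by rewrite -preimage_bigcup; exact: mpre.
Qed.

HB.instance Definition _ := isMeasure.Build _ _ _
  borel_lebesgue_step step0 step_ge0 step_sigma_additive.

Let uncons (t : n.+1.-tuple R) : R * n.-tuple R :=
  (thead t, [tuple of behead t]).

Let cons_tupleK : cancel cons_tuple uncons.
Proof.
move=> [x t]; rewrite /uncons /cons_tuple /= theadE; congr pair.
exact/val_inj.
Qed.

Let measurable_uncons : measurable_fun setT uncons.
Proof.
apply/measurable_fun_pairP; split.
  exact: measurable_tnth.
exact: measurable_behead.
Qed.

Let step_sigma_finite : sigma_finite setT borel_lebesgue_step.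
Proof.
have /sigma_finiteP[F [TF ndF Foo]] := sigma_finiteT (@lebesgue_measure R).
have /sigma_finiteP[G [TG ndG Goo]] := sigma_finiteT m.
exists (fun i => uncons @^-1` (F i `*` G i)).
  rewrite -preimage_bigcup (_ : \bigcup_i _ = setT) ?preimage_setT//.
  rewrite -setXTT TF TG predeqE => -[x y]; split.
    by move=> [k _ [/= Fkx Gky]]; split; exists k.
  move=> [/= [i _ Fix] [k _ Gky]]; exists (maxn i k) => //; split.
    by move: x Fix; exact/subsetPset/ndF/leq_maxl.
  by move: y Gky; exact/subsetPset/ndG/leq_maxr.
move=> i; have [mF Fi] := Foo i; have [mG Gi] := Goo i; split.
  rewrite -[X in measurable X]setTI; apply: measurable_uncons => //.
  exact: measurableX.
rewrite /borel_lebesgue_step /pushforward -comp_preimage.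
rewrite (_ : uncons \o cons_tuple = id) ?preimage_id; last exact/funext.
by rewrite product_measure1E// lte_mul_pinfty// ge0_fin_numE.
Qed.

HB.instance Definition _ := Measure_isSigmaFinite.Build _ _ _
  borel_lebesgue_step step_sigma_finite.

End borel_lebesgue_step.

Fixpoint borel_lebesgue (R : realType) (n : nat) :
    {sigma_finite_measure set (n.-tuple R) -> \bar R} :=
  match n with
  | 0%N => dirac [the 0.-tuple R of [::]]
  | n'.+1 => borel_lebesgue_step (borel_lebesgue R n')
  end.

Definition Rn (R : realType) (n : nat) : Type :=
  caratheodory_type ((borel_lebesgue R n)^*)%mu.

HB.instance Definition _ (R : realType) (n : nat) :=
  Measurable.copy (Rn R n) (caratheodory_type ((borel_lebesgue R n)^*)%mu).

Definition leb (R : realType) (n : nat) : {measure set (Rn R n) -> \bar R} :=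
  @completed_measure_extension _ _ _ (borel_lebesgue R n).

Section euclidean.
Context {R : realType} {n : nat}.
Implicit Types x y : Rn R n.

Definition enorm x : R := Num.sqrt (\sum_(i < n) tnth x i ^+ 2)%R.

Definition edist x y : R :=
  Num.sqrt (\sum_(i < n) (tnth x i - tnth y i) ^+ 2)%R.

(* The i-th edge contains its lower endpoint iff [lo i] is true, and its upper
   endpoint iff [hi i] is false. *)
Definition cube (Q : set (Rn R n)) : Prop :=
  exists (a : 'I_n -> R) (l : R) (lo hi : 'I_n -> bool), (0 < l)%R /\
    Q = [set x : Rn R n | forall i : 'I_n,
           tnth x i \in Interval (BSide (lo i) (a i)) (BSide (hi i) (a i + l)%R)].

(* The closed cube centered at the origin with edge length 2e. *)
Definition cube0 : set (Rn R n) :=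
  [set x : Rn R n | forall i : 'I_n, tnth x i \in `[- expR 1, expR 1]%R].

End euclidean.

Section weights.
Context {R : realType} {n : nat}.
Local Notation mu := (@leb R n).
Implicit Types (p r f v w : Rn R n -> R) (Q : set (Rn R n)).

Definition average Q f : \bar R := (mu Q)^-1 * \int[mu]_(x in Q) (f x)%:E.

Definition exponent (p : Rn R n -> \bar R) : Prop :=
  measurable_fun setT p /\ forall x, 1 <= p x.

(* r belongs to LH, with witnesses rinf, C0 and Cinf. For x = y the right-hand
   side is 0, since the library sets ln 0 = 0 and 0^-1 = 0. *)
Definition log_holder r (rinf C0 Cinf : R) : Prop :=
  [/\ measurable_fun setT r,
      [/\ 0 < C0, 0 < rinf & 0 < Cinf]%R,
      forall x y, (edist x y < 2^-1)%R ->
        (`|r x - r y| <= - (C0 / ln (edist x y)))%R &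
      forall x, (`|r x - rinf| <= Cinf / ln (expR 1 + enorm x))%R].

(* An exponent p in P and LH (hence real-valued) whose essential infimum and
   supremum are pmin and pmax, and whose LH constants are pinf, C0 and Cinf:
   these five numbers are what a constant "depending only on p" may use. *)
Definition LH_exponent (pmin pmax pinf C0 Cinf : R) p : Prop :=
  [/\ exponent (EFin \o p), log_holder p pinf C0 Cinf,
      ess_inf mu (EFin \o p) = pmin%:E & ess_sup mu (EFin \o p) = pmax%:E].

(* Luxemburg norm, for a real-valued exponent p. *)
Definition Lpnorm p f : \bar R :=
  ereal_inf [set l%:E | l in [set l : R | (0 < l)%R /\
    \int[mu]_x (`|f x / l| `^ p x)%:E <= 1]].

Definition weight w : Prop :=
  [/\ measurable_fun setT w, forall x, (0 <= w x)%R &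
      {ae mu, forall x, (0 < w x)%R}].

(* Product of non-negative extended reals with oo * 0 = oo (the library's
   product has oo * 0 = 0). *)
Definition mul_infty (x y : \bar R) : \bar R :=
  if (x == +oo) || (y == +oo) then +oo else x * y.

(* exp of the average of log (w^-1) over Q. *)
Definition exp_average_log_inv w Q : \bar R :=
  expeR (average Q (fun x => ln (w x)^-1)).

Definition Ap_infty_const p w : \bar R :=
  ereal_sup [set mul_infty ((Lpnorm p \1_Q)^-1 * Lpnorm p (w \* \1_Q)%R)
                           (exp_average_log_inv w Q) | Q in cube].

Definition Ap_infty p w : Prop := weight w /\ Ap_infty_const p w < +oo.

Definition A_infty_const v : \bar R :=
  ereal_sup [set mul_infty (average Q v) (exp_average_log_inv v Q) | Q in cube].

Definition A_infty v : Prop := weight v /\ A_infty_const v < +oo.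

End weights.

(* The defining property of the constant tau_n. *)
Definition reverse_holder_constant (R : realType) (n : nat) (tau : R) : Prop :=
  (0 < tau)%R /\
  forall v : Rn R n -> R, A_infty v ->
  forall r : R, (1 <= r <= 1 + (tau * fine (A_infty_const v))^-1)%R ->
  forall Q : set (Rn R n), cube Q ->
    average Q (fun x => v x `^ r)%R `^ (r^-1)%R <= 2%:E * average Q v.

(* The defining property of the constant C_{p,n}. As this constant depends only
   on n and the five numbers attached to p, the inequality is required for every
   exponent sharing these numbers. *)
Definition average_norm_constant (R : realType) (n : nat)
    (pmin pmax pinf C0 Cinf K : R) : Prop :=
  (0 < K)%R /\
  forall p : Rn R n -> R, LH_exponent pmin pmax pinf C0 Cinf p ->
  forall (f : Rn R n -> R) (Q : set (Rn R n)), measurable_fun setT f -> cube Q ->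
    average Q (fun x => `|f x|%R)
      <= K%:E * ((Lpnorm p \1_Q)^-1 * Lpnorm p (f \* \1_Q)%R).

(* Main.v *)
Require Import Defs.
From HB Require Import structures.
From mathcomp Require Import all_boot all_order all_algebra.
From mathcomp Require Import all_classical all_reals all_analysis.
From mathcomp Require Import measurable_realfun ess_sup_inf.
From mathcomp Require Import ring lra.

Set Implicit Arguments.
Unset Strict Implicit.

Import Order.TTheory GRing.Theory Num.Theory.
Import numFieldNormedType.Exports.

Local Open Scope classical_set_scope.
Local Open Scope ring_scope.
Local Open Scope ereal_scope.

(** The weight w is a classical A_oo weight, and the theorem for W = w ^ p is deduced
    from it by comparing norms.

    Let N_Q and L_Q be the norms of w 1_Q and 1_Q, and let [w] be the A_{p,oo}
    constant. Jensen's inequality and the average-norm inequality show that the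
    geometric mean of w over Q is at most its arithmetic mean, which is at most
    Cp N_Q / L_Q; the definition of [w] bounds N_Q / L_Q by [w] times the geometric
    mean ([Ap_cube]). So the two means are comparable with factor Cp [w], which has two
    consequences.

    First, w satisfies the reverse Hoelder inequality with the exponent delta. If E
    fills Q up to a proportion alpha, then E carries at least the proportion
    eta = 1 - 2 alpha ^ (1 - 1/delta) of the integral of w, and this gives N_Q <= D N_E
    with D = Cp [w] / eta ([weight_norm_large_subset]).

    Secondly, ln w has mean oscillation at most b = 2 + ln (Cp [w]) over every cube
    ([ln_mean_osc]), so ln N_Q changes by a multiple of b when the edge of Q is doubled
    ([ln_weight_norm_dilate]). All losses below are of the form exp (O(b)), that is,
    powers of [w].

    The integral of (w / N_Q) ^ p over Q is at most 1, and with M = N_Q / D the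
    integral of (w / M) ^ p over E is at least 1. It remains to replace N_Q ^ p and M ^ p
    by constants. If N_Q <= 1, let k be the number of doublings leading from Q to a cube
    that contains Q0. Then - ln N_Q is O(b k), up to |ln N_{Q0}|, whereas log-Hoelder
    continuity makes k times the oscillation of p over Q bounded ([osc_chain]). If N_Q is
    large, take a cube about the origin obtained from Q0 by j doublings, with j a small
    multiple of ln M / b. Its norm is much smaller than M, so it contributes little to
    the integrals, while outside it |p - pinf| ln M is O(b), so that M ^ p is comparable
    to M ^ pinf ([W_le_far], [W_ge_far]). The powers of N_{Q0} lost in the upper and in
    the lower bound multiply to the single factor L_w. [W_compare] collects the cases.

    The same arguments show that the integral of W over Q is comparable to the power
    of N_Q whose exponent is the mean p_Q of p ([modular_mean_exponent]). For w and for
    the weight 1 this bounds the average of W by a multiple of (N_Q / L_Q) ^ p_Q. As ln w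
    is close to ln (N_Q / L_Q) on average, the geometric mean of W is bounded below by
    the same power, so W belongs to A_oo ([A_infty_power]). *)

(** * Cubes and Lebesgue measure *)

Definition ccube {R : realType} {n : nat} (c : 'I_n -> R) (r : R) : set (Rn R n) :=
  [set x : Rn R n | forall i : 'I_n, tnth x i \in `[c i - r, c i + r]%R].

Lemma borel_lebesgue_box {R : realType} (n : nat) (I : 'I_n -> set R) :
    (forall i, measurable (I i)) ->
  measurable [set t : n.-tuple R | forall i, I i (tnth t i)] /\
  borel_lebesgue R n [set t : n.-tuple R | forall i, I i (tnth t i)] =
    \prod_(i < n) lebesgue_measure (I i).
Proof.
elim: n I => [|n IH] I mI.
  have -> : [set t : 0.-tuple R | forall i, I i (tnth t i)] = setT.
    by apply/seteqP; split => // t _ [].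
  split; first exact: measurableT.
  by rewrite big_ord0 /= diracT.
have [mB eB] := IH (fun i => I (lift ord0 i)) (fun i => mI _).
have prebox : @Defs.cons_tuple R n @^-1` [set t : n.+1.-tuple R | forall i, I i (tnth t i)] =
    I ord0 `*` [set t : n.-tuple R | forall i, I (lift ord0 i) (tnth t i)].
  apply/seteqP; split => -[x t] /= => [h|[h0 h1] i].
    split; first exact: (h ord0).
    by move=> i; have := h (lift ord0 i); rewrite tnthS.
  by case: (unliftP ord0 i) => [j|] ->; rewrite ?tnthS ?tnth0.
have mS : measurable [set t : n.+1.-tuple R | forall i, I i (tnth t i)].
  have -> : [set t : n.+1.-tuple R | forall i, I i (tnth t i)] =
      \bigcap_(i in [set: 'I_n.+1]) ((fun t => tnth t i) @^-1` I i).
    by apply/seteqP; split => t /= h i; [move=> _; exact: h|exact: (h i)].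
  apply: fin_bigcap_measurable => // i _.
  rewrite -[X in measurable X]setTI; exact: measurable_tnth.
split => //; rewrite /= /borel_lebesgue_step /pushforward.
rewrite prebox product_measure1E//; last exact: mI.
by rewrite big_ord_recl -eB.
Qed.

Section cubes.
Context {R : realType} {n : nat}.
Local Notation mu := (@leb R n).
Implicit Types (Q : set (Rn R n)) (c : 'I_n -> R) (r : R).

Lemma leb_borel (A : set (n.-tuple R)) : measurable A ->
  measurable (A : set (Rn R n)) /\ mu A = borel_lebesgue R n A.
Proof.
move=> mA; split; first exact: (caratheodory_measurable_mu_ext (borel_lebesgue R n) mA).
exact: (measurable_mu_extE (borel_lebesgue R n) mA).
Qed.

(** Whichever endpoints a cube contains, it lies in a closed cube of the same
    measure; dilations are taken of that closed cube. *)
Lemma cube_measure Q : cube Q -> exists c r,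
  [/\ (0 < r)%R, measurable Q, mu Q = ((2 * r) ^+ n)%:E & Q `<=` ccube c r].
Proof.
move=> [a [l [lo [hi [l0 ->]]]]].
exists (fun i => a i + l / 2)%R, (l / 2)%R.
have [|mB eB] := @borel_lebesgue_box R n
  (fun i => [set` Interval (BSide (lo i) (a i)) (BSide (hi i) (a i + l)%R)]).
  by move=> i; exact: measurable_itv.
have [mB' eB'] := leb_borel mB.
split.
- by rewrite divr_gt0.
- exact: mB'.
- rewrite [LHS]eB' eB (eq_bigr (fun=> l%:E)).
    rewrite -(big_morph EFin EFinM erefl) prodr_const card_ord.
    by congr (_ ^+ _)%:E; field.
  move=> i _; rewrite lebesgue_measure_itv /= lte_fin ltrDl l0.
  by rewrite -EFinD addrAC subrr add0r.
- move=> x /= h i; have := h i; rewrite !itv_boundlr.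
  have -> : (a i + l / 2 - l / 2 = a i)%R by rewrite addrK.
  have -> : (a i + l / 2 + l / 2 = a i + l)%R by field.
  move=> /andP[h1 h2]; apply/andP; split.
    by apply: le_trans h1; rewrite bnd_simp; case: (lo i).
  by apply: (le_trans h2); rewrite bnd_simp; case: (hi i).
Qed.

Lemma cube_ccube c r : (0 < r)%R -> cube (ccube c r).
Proof.
move=> r0; exists (fun i => c i - r)%R, (2 * r)%R, xpredT, xpred0; split; first lra.
by congr [set x | _]; apply/funext => x; apply/propext; split => h i;
  have := h i; rewrite (_ : c i - r + 2 * r = c i + r)%R//; ring.
Qed.

End cubes.

(** * Log-Hoelder exponents *)

Section log_holder_exponents.
Context {R : realType} {n : nat}.
Hypothesis n_gt0 : (0 < n)%N.
Local Notation mu := (@leb R n).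
Local Open Scope ring_scope.
Implicit Types (x y : Rn R n) (c : 'I_n -> R) (r : R).

Lemma coord_le_enorm x (i : 'I_n) : `|tnth x i| <= enorm x.
Proof.
rewrite -sqrtr_sqr ler_wsqrtr// (bigD1 i)//= lerDl.
by apply: sumr_ge0 => j _; exact: sqr_ge0.
Qed.

Lemma edist_ccube c r x y : 0 < r -> ccube c r x -> ccube c r y ->
  Defs.edist x y <= 2 * n%:R * r.
Proof.
move=> r0 cx cy; rewrite /Defs.edist.
have nR_ge1 : 1 <= n%:R :> R by rewrite ler1n.
have h0 : 0 <= 2 * n%:R * r by rewrite !mulr_ge0// ltW.
rewrite -(@ger0_norm _ (2 * n%:R * r))// -sqrtr_sqr ler_wsqrtr//.
apply: (@le_trans _ _ (\sum_(i < n) (2 * r) ^+ 2)).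
  apply: ler_sum => i _.
  have /andP[a1 a2] := cx i; have /andP[b1 b2] := cy i.
  by rewrite !bnd_simp in a1 a2 b1 b2; nra.
rewrite sumr_const card_ord -[leLHS]mulr_natr.
rewrite (_ : (2 * n%:R * r) ^+ 2 = (2 * r) ^+ 2 * n%:R * n%:R); last by ring.
by rewrite ler_peMr// mulr_ge0// sqr_ge0.
Qed.

Lemma ex_ae_cube (Q : set (Rn R n)) (P : Rn R n -> Prop) : cube Q ->
  {ae mu, forall x, P x} -> exists2 x, Q x & P x.
Proof.
move=> cQ [N [mN N0 PN]]; apply: contrapT => h.
have [c [r [r0 mQ eQ _]]] := cube_measure cQ.
have : (mu Q <= mu N)%E.
  apply: le_measure; rewrite ?inE// => x Qx; apply: PN => /= Px.
  by apply: h; exists x.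
by rewrite N0 eQ lee_fin leNgt exprn_gt0// mulr_gt0.
Qed.

Lemma ln2_ge : 1 / 2 <= ln 2 :> R.
Proof.
rewrite -ler_expR lnK ?posrE//.
have := @expR_ge1Dx R (- (1 / 2)); rewrite expRN => h.
have e0 := @expR_gt0 R (1 / 2).
rewrite -[leLHS]invrK -[leRHS]invrK lef_pV2 ?posrE ?invr_gt0//.
by apply: le_trans h; lra.
Qed.

Variables (pmin pmax pinf C0 Cinf : R) (p : Rn R n -> R).
Hypothesis hp : LH_exponent pmin pmax pinf C0 Cinf p.

Lemma LH_local c r x y : 0 < r -> 2 * n%:R * r <= 1 / 4 ->
  ccube c r x -> ccube c r y -> `|p x - p y| <= C0 / - ln (2 * n%:R * r).
Proof.
move=> r0 rn cx cy; have [_ [_ [C00 _ _] loc _] _ _] := hp.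
have d0 := edist_ccube r0 cx cy.
have n0 : 0 < 2 * n%:R * r :> R by rewrite !mulr_gt0// ltr0n.
have l0 : 0 < - ln (2 * n%:R * r) by rewrite oppr_gt0 ln_lt0// n0/=; lra.
have /loc h : Defs.edist x y < 2^-1 by lra.
apply: (le_trans h).
have [e0|e0] := ltP 0 (Defs.edist x y).
  rewrite -mulrN -invrN ler_pM2l// lef_pV2 ?posrE//.
    by rewrite lerN2 ler_ln ?posrE.
  by rewrite oppr_gt0 ln_lt0// e0/=; lra.
by rewrite ln0// invr0 mulr0 oppr0 divr_ge0// ltW.
Qed.

Lemma LH_decay x (i : 'I_n) (a : R) : 0 <= a -> a <= `|tnth x i| ->
  `|p x - pinf| <= Cinf / ln (expR 1 + a).
Proof.
move=> a0 ax; have [_ [_ [_ _ Ci0] _ dec] _ _] := hp.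
apply: (le_trans (dec x)); rewrite ler_pM2l//.
have e1 : 1 < expR 1 :> R by rewrite expR_gt1.
have ex := le_trans ax (coord_le_enorm x i).
rewrite lef_pV2 ?posrE ?ln_gt0//; try lra.
by rewrite ler_ln ?posrE; lra.
Qed.

(** p is continuous and the essential bounds hold almost everywhere, hence at
    points arbitrarily close to x. *)
Lemma LH_bounds x : pmin <= p x <= pmax.
Proof.
have [_ [_ [C00 _ _] _ _] emin emax] := hp.
have amin : {ae mu, forall x, pmin <= p x}.
  have := @ess_inf_le _ _ _ mu (EFin \o p); rewrite emin.
  by apply: filterS => z /=; rewrite lee_fin.
have amax : {ae mu, forall x, p x <= pmax}.
  have := @ess_sup_ge _ _ _ mu (EFin \o p); rewrite emax.
  by apply: filterS => z /=; rewrite lee_fin.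
have near_ae (P : Rn R n -> Prop) eps : 0 < eps -> {ae mu, forall x, P x} ->
    exists2 y, P y & `|p x - p y| <= eps.
  move=> e0 aeP.
  (* this makes C0 / - ln (2 n r) smaller than eps, and 2 n r at most 1/4 *)
  pose r : R := expR (- (C0 / eps) - 2) / (2 * n%:R).
  have n2 : 0 < 2 * n%:R :> R by rewrite mulr_gt0// ltr0n.
  have r0 : 0 < r by rewrite divr_gt0// expR_gt0.
  have er : 2 * n%:R * r = expR (- (C0 / eps) - 2).
    by rewrite /r mulrC divfK// gt_eqF.
  have ce0 : 0 < C0 / eps by rewrite divr_gt0.
  have small : 2 * n%:R * r <= 1 / 4.
    rewrite er (_ : - (C0 / eps) - 2 = - (C0 / eps + 2)); last lra.
    rewrite expRN div1r lef_pV2 ?posrE// ?expR_gt0//.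
    have h1 := @expR_ge1Dx R 1; have h2 : expR (1 + 1) <= expR (C0 / eps + 2) :> R.
      by rewrite ler_expR; lra.
    by apply: le_trans h2; rewrite expRD; nra.
  pose c := fun i => tnth x i.
  have cx : ccube c r x.
    by move=> i; rewrite itv_boundlr /= !bnd_simp /c; apply/andP; split; lra.
  have [y Qy Py] := ex_ae_cube (cube_ccube c r0) aeP.
  exists y => //; apply: (le_trans (LH_local r0 small cx Qy)).
  rewrite er expRK opprD !opprK.
  rewrite ler_pdivrMr; last lra.
  by rewrite mulrDr mulrCA divff ?gt_eqF// mulr1; lra.
apply/andP; split; apply/ler_addgt0Pr => e e0.
  have [y Py] := near_ae _ _ e0 amin; rewrite ler_norml => /andP[]; lra.
have [y Py] := near_ae _ _ e0 amax; rewrite ler_norml => /andP[]; lra.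
Qed.

Lemma LH_pmin_ge1 : 1 <= pmin.
Proof.
have [[_ ep] _ emin _] := hp.
rewrite -lee_fin -emin; apply/ess_infP; apply: nearW => x /=; exact: ep.
Qed.

(** pinf is the limit of p along the diagonal. *)
Lemma LH_pinf_bounds : pmin <= pinf <= pmax.
Proof.
have [_ [_ [_ _ Ci0] _ _] _ _] := hp.
pose i0 := Ordinal n_gt0.
have far eps : 0 < eps -> exists x, `|p x - pinf| <= eps.
  move=> e0; pose a := expR (Cinf / eps).
  have a0 : 0 < a by exact: expR_gt0.
  exists [the n.-tuple R of nseq n a].
  apply: (le_trans (@LH_decay _ i0 _ (ltW a0) _)).
    by rewrite tnth_nseq ger0_norm// ltW.
  have e1 : 1 < expR 1 :> R by rewrite expR_gt1.
  rewrite ler_pdivrMr ?ln_gt0//; try lra.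
  rewrite mulrC -ler_pdivrMr// -[leLHS]expRK ler_ln ?posrE//; rewrite -/a; lra.
apply/andP; split; apply/ler_addgt0Pr => e e0; have [x] := far _ e0;
  have /andP[] := LH_bounds x; rewrite ler_norml => ? ? /andP[]; lra.
Qed.

Lemma LH_osc_le x y : `|p x - p y| <= pmax.
Proof.
have /andP[? ?] := LH_bounds x; have /andP[? ?] := LH_bounds y.
by have := LH_pmin_ge1; rewrite ler_norml => ?; apply/andP; split; lra.
Qed.

End log_holder_exponents.

Section oscillation.
Context {R : realType} {n : nat}.
Hypothesis n_gt0 : (0 < n)%N.
Local Open Scope ring_scope.

Lemma ccube_far_coord (c : 'I_n -> R) r (x : Rn R n) :
  0 < r -> r < (\sum_i `|c i|) / (2 * n%:R) -> ccube c r x ->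
  exists i, (\sum_i `|c i|) / (2 * n%:R) <= `|tnth x i|.
Proof.
move=> r0 rs cx; apply: contrapT => h.
have n0 : 0 < n%:R :> R by rewrite ltr0n.
set t := _ / _ in rs h.
have ht i : `|c i| <= t + r.
  have xi : `|tnth x i| < t by rewrite ltNge; apply/negP => ?; apply: h; exists i.
  have := cx i; rewrite itv_boundlr !bnd_simp => /andP[h1 h2].
  by move: xi; rewrite ltr_norml => /andP[h3 h4]; rewrite ler_norml; apply/andP; split; lra.
have : \sum_i `|c i| <= \sum_(i < n) (t + r) by apply: ler_sum => i _; exact: ht.
rewrite sumr_const card_ord -[leRHS]mulr_natr.
have -> : \sum_i `|c i| = (2 * t) * n%:R.
  by rewrite /t; field; rewrite gt_eqF.
rewrite ler_pM2r//; lra.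
Qed.

(** The least k such that the k-fold dilate of a cube Q of center c and radius r
    contains Q0 is comparable to ln ((e + |c|) / r), |c| being the sum of the
    absolute coordinates. The contribution ln (1 / r) is absorbed by the local
    modulus of continuity of p. If Q is small compared with |c|, all its points are
    at distance of order |c| from the origin and the decay of p - pinf absorbs
    ln (e + |c|); otherwise (e + |c|) / r is bounded by a multiple of 1 + 1 / r. *)
Lemma osc_chain (pmin pmax pinf C0 Cinf : R) : exists2 K : R, 0 <= K &
  forall p : Rn R n -> R, LH_exponent pmin pmax pinf C0 Cinf p ->
  forall (c : 'I_n -> R) r, 0 < r -> exists k : nat,
    cube0 `<=` ccube c (2 ^+ k * r) /\
    forall x y, ccube c r x -> ccube c r y -> `|p x - p y| * k.+1%:R <= K.
Proof.
have nR1 : 1 <= n%:R :> R by rewrite ler1n.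
have E1 : 2 <= expR 1 :> R by have := @expR_ge1Dx R 1; lra.
have [[p0 hp0]|nex] := pselect (exists p : Rn R n -> R,
    LH_exponent pmin pmax pinf C0 Cinf p); last first.
  by exists 0 => // p hp; exfalso; apply: nex; exists p.
have [_ [_ [C00 _ Ci0] _ _] _ _] := hp0.
have pmax1 : 1 <= pmax.
  have := LH_pmin_ge1 hp0; have := LH_bounds n_gt0 hp0 [the n.-tuple R of nseq n 0].
  by move=> /andP[]; lra.
pose K1 := C0 * (1 + ln (2 * n%:R)) + pmax * ln (8 * n%:R).
have ln2n : 0 <= ln (2 * n%:R) :> R by apply: ln_ge0; lra.
have ln8n : 0 <= ln (8 * n%:R) :> R by apply: ln_ge0; lra.
have lnE2 : 0 <= ln (expR 1 + 2 * n%:R) :> R by apply: ln_ge0; lra.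
have K1_ge : 0 <= K1 by rewrite addr_ge0// mulr_ge0; lra.
pose K2 := K1 + pmax * ln (expR 1 + 2 * n%:R) + 2 * Cinf * (ln (2 * n%:R) + 1).
have K2_ge : 0 <= K2.
  by rewrite !addr_ge0// mulr_ge0//; lra.
exists (2 * pmax + 2 * K2); first by lra.
move=> p hp c r r0.
set s := \sum_i `|c i|.
have s0 : 0 <= s by apply: sumr_ge0.
have ex_k : exists k, expR 1 + s <= 2 ^+ k * r.
  exists (Num.bound ((expR 1 + s) / r)).
  rewrite -ler_pdivrMr// ltW//; apply: (lt_le_trans (archi_boundP _)).
    by rewrite divr_ge0; lra.
  by rewrite -natrX ler_nat ltnW// ltn_expl.
have [k hk kmin] := ex_minnP ex_k.
exists k; split.
  move=> x x0 i; have := x0 i; rewrite !itv_boundlr !bnd_simp => /andP[h1 h2].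
  have : `|c i| <= s by rewrite /s (bigD1 i)//= lerDl sumr_ge0.
  by rewrite ler_norml => /andP[h3 h4]; apply/andP; split; lra.
move=> x y cx cy.
set o := `|_|; have o0 : 0 <= o by exact: normr_ge0.
have omax : o <= pmax := LH_osc_le n_gt0 hp x y.
case: k => [|k] in hk kmin *; first by rewrite mulr1; lra.
have small : 2 ^+ k * r < expR 1 + s.
  by rewrite ltNge; apply/negP => /kmin; rewrite ltnn.
have k2 : k%:R <= 2 * (ln (expR 1 + s) - ln r).
  have h : ln (2 ^+ k * r) <= ln (expR 1 + s).
    by rewrite ler_ln ?posrE ?mulr_gt0 ?exprn_gt0//; lra.
  move: h; rewrite lnM ?posrE ?exprn_gt0// lnXn// -[ln 2 *+ k]mulr_natr => h.
  have := @ln2_ge R; have : 0 <= k%:R :> R by []. nra.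
(* local modulus of continuity *)
have or : o * - ln r <= K1.
  have [rs|rs] := leP (2 * n%:R * r) (1 / 4).
    have h := LH_local n_gt0 hp r0 rs cx cy; rewrite -/o in h.
    have n0 : 0 < 2 * n%:R * r by rewrite !mulr_gt0//; lra.
    have u1 : 1 <= - ln (2 * n%:R * r).
      have : ln (2 * n%:R * r) <= ln ((2 * 2)^-1).
        rewrite ler_ln ?posrE//; by apply: (le_trans rs); rewrite invfM; lra.
      have l4 : ln ((2 * 2)^-1) = - (ln 2 + ln 2) :> R.
        by rewrite lnV ?posrE// lnM ?posrE.
      by rewrite l4; have := @ln2_ge R; lra.
    have er : - ln r = - ln (2 * n%:R * r) + ln (2 * n%:R).
      rewrite [ln (_ * r)]lnM ?posrE//; first by ring.
      by rewrite mulr_gt0//; lra.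
    have h1 : o * - ln (2 * n%:R * r) <= C0.
      by rewrite -ler_pdivlMr//; lra.
    rewrite er mulrDr; set u := - ln (2 * n%:R * r) in h1 u1 *.
    have h2 : o <= C0 by nra.
    have h3 : o * ln (2 * n%:R) <= C0 * ln (2 * n%:R) by rewrite ler_wpM2r.
    have h4 : 0 <= pmax * ln (8 * n%:R) by rewrite mulr_ge0//; lra.
    by rewrite /K1; lra.
  have h : - ln r <= ln (8 * n%:R).
    have n8 : 0 < 8 * n%:R :> R by lra.
    rewrite -lnV ?posrE// ler_ln ?posrE ?invr_gt0// -div1r ler_pdivrMr//.
    lra.
  have h1 : o * - ln r <= o * ln (8 * n%:R) by rewrite ler_wpM2l.
  have h2 : o * ln (8 * n%:R) <= pmax * ln (8 * n%:R) by rewrite ler_wpM2r.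
  have h3 : 0 <= C0 * (1 + ln (2 * n%:R)) by rewrite mulr_ge0//; lra.
  by rewrite /K1; lra.
have key : o * (ln (expR 1 + s) - ln r) <= K2.
  have Ci2 : 0 <= 2 * Cinf * (ln (2 * n%:R) + 1) by apply: mulr_ge0; lra.
  have pm2 : 0 <= pmax * ln (expR 1 + 2 * n%:R) by rewrite mulr_ge0//; lra.
  have [rs|rs] := ltP r (s / (2 * n%:R)).
    set a := s / (2 * n%:R) in rs.
    have a0 : 0 < a by lra.
    have dec z : ccube c r z -> `|p z - pinf| <= Cinf / ln (expR 1 + a).
      move=> cz; have [i hi] := ccube_far_coord r0 rs cz.
      exact: (LH_decay hp (ltW a0) hi).
    have la : 1 <= ln (expR 1 + a).
      by rewrite -[leLHS](@expRK R) ler_ln ?posrE; lra.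
    have oa : o <= 2 * Cinf / ln (expR 1 + a).
      rewrite /o (_ : p x - p y = (p x - pinf) - (p y - pinf)); last by ring.
      apply: (le_trans (ler_normB _ _)); have := dec _ cx; have := dec _ cy; lra.
    rewrite ler_pdivlMr in oa; last lra.
    have es : ln (expR 1 + s) <= ln (2 * n%:R) + ln (expR 1 + a).
      rewrite -lnM ?posrE; try lra.
      have -> : s = 2 * n%:R * a by rewrite /a mulrC divfK//; rewrite gt_eqF//; lra.
      rewrite ler_ln ?posrE; nra.
    have h1 : o * ln (expR 1 + s) <= 2 * Cinf * (ln (2 * n%:R) + 1).
      apply: (@le_trans _ _ (o * (ln (2 * n%:R) + ln (expR 1 + a)))).
        by rewrite ler_wpM2l.
      have o1 : o <= 2 * Cinf by nra.
      have : o * ln (2 * n%:R) <= 2 * Cinf * ln (2 * n%:R) by rewrite ler_wpM2r.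
      by lra.
    by rewrite /K2 mulrBr; lra.
  have sr : s <= 2 * n%:R * r.
    by move: rs; rewrite ler_pdivrMr; lra.
  have [r1|r1] := leP 1 r.
    have h : ln (expR 1 + s) - ln r <= ln (expR 1 + 2 * n%:R).
      rewrite lerBlDr -lnM ?posrE; try lra.
      rewrite ler_ln ?posrE; nra.
    have h1 : o * (ln (expR 1 + s) - ln r) <= o * ln (expR 1 + 2 * n%:R).
      by rewrite ler_wpM2l.
    have h2 : o * ln (expR 1 + 2 * n%:R) <= pmax * ln (expR 1 + 2 * n%:R).
      by rewrite ler_wpM2r.
    by rewrite /K2; lra.
  have h : ln (expR 1 + s) <= ln (expR 1 + 2 * n%:R).
    rewrite ler_ln ?posrE; nra.
  have h1 : o * ln (expR 1 + s) <= o * ln (expR 1 + 2 * n%:R).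
    by rewrite ler_wpM2l.
  have h2 : o * ln (expR 1 + 2 * n%:R) <= pmax * ln (expR 1 + 2 * n%:R).
    by rewrite ler_wpM2r.
  by rewrite /K2 mulrBr; lra.
rewrite (_ : k.+2%:R = k%:R + 2); last by rewrite -addn2 natrD.
have : o * k%:R <= 2 * (o * (ln (expR 1 + s) - ln r)).
  by rewrite mulrCA ler_wpM2l.
by lra.
Qed.

End oscillation.

(** * Luxemburg norms and modulars on a measure space *)

Lemma measurable_powR_fun d (T : measurableType d) (R : realType) (D : set T)
    (f g : T -> R) : measurable D ->
  measurable_fun D f -> measurable_fun D g -> measurable_fun D (fun x => f x `^ g x)%R.
Proof.
move=> mD mf mg; rewrite /powR; apply: measurable_fun_if => //.
- exact: measurable_fun_eqr.
- apply: (@measurableT_comp _ _ _ _ _ _ (fun b : bool => b%:R : R)%R) => //.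
  apply: (@measurable_fun_eqr _ _ _ _ g (cst 0%R)) => //.
    by apply: measurable_funS mg => //; exact: subIsetl.
- apply: (@measurableT_comp _ _ _ _ _ _ (@expR R)) => //.
  apply: measurable_funM.
    by apply: measurable_funS mg => //; exact: subIsetl.
  apply: (@measurableT_comp _ _ _ _ _ _ (@ln R)) => //.
  by apply: measurable_funS mf => //; exact: subIsetl.
Qed.

Section luxemburg.
Context {d : measure_display} {T : measurableType d} {R : realType}.
Variable mu : {measure set T -> \bar R}.
Implicit Types (f g h w : T -> R) (S : set T).

Lemma ge0_le_integralZ S g h (k : R) : measurable S ->
    measurable_fun S g -> measurable_fun S h -> (0 <= k)%R ->
    (forall x, S x -> 0 <= g x)%R -> (forall x, S x -> 0 <= h x)%R ->
    (forall x, S x -> g x <= k * h x)%R ->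
  \int[mu]_(x in S) (g x)%:E <= k%:E * \int[mu]_(x in S) (h x)%:E.
Proof.
move=> mS mg mh k0 g0 h0 gh.
have g0' x : S x -> 0 <= (g x)%:E by move=> Sx; rewrite lee_fin g0.
have h0' x : S x -> 0 <= (h x)%:E by move=> Sx; rewrite lee_fin h0.
have mg' : measurable_fun S (fun x => (g x)%:E) by exact/measurable_EFinP.
have mh' : measurable_fun S (fun x => (h x)%:E) by exact/measurable_EFinP.
have mkh : measurable_fun S (fun x => k%:E * (h x)%:E).
  by apply: (measurable_funeM k%:E mh').
rewrite -(ge0_integralZl_EFin mu mS h0' mh' k0).
apply: (ge0_le_integral mu mS g0' mg' mkh) => x Sx.
by rewrite -EFinM lee_fin; exact: gh.
Qed.

Variables (p : T -> R) (P : R).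
Hypothesis mp : measurable_fun setT p.
Hypothesis p1 : forall x, (1 <= p x <= P)%R.
Hypothesis P1 : (1 <= P)%R.

(** [Lpnorm] is the case of Lebesgue measure on R^n. *)
Definition luxemburg f : \bar R :=
  ereal_inf [set l%:E | l in [set l : R | (0 < l)%R /\
    \int[mu]_x (`|f x / l| `^ p x)%:E <= 1]].

Definition modular f S : \bar R := \int[mu]_(x in S) (f x `^ p x)%:E.

Lemma modular_ge0 f S : 0 <= modular f S.
Proof. by apply: integral_ge0 => x _; rewrite lee_fin powR_ge0. Qed.

Lemma measurable_powRp f S : measurable S -> measurable_fun setT f ->
  measurable_fun S (fun x => f x `^ p x)%R.
Proof.
move=> mS mf; apply: measurable_powR_fun => //.
  exact: measurable_funS mf.
exact: measurable_funS mp.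
Qed.

Lemma modular_le f g k S : measurable S ->
    measurable_fun setT f -> measurable_fun setT g -> (0 <= k)%R ->
    (forall x, S x -> f x `^ p x <= k * g x `^ p x)%R ->
  modular f S <= k%:E * modular g S.
Proof.
move=> mS mf mg k0 fg; apply: ge0_le_integralZ => //; try exact: measurable_powRp.
- by move=> x _; exact: powR_ge0.
- by move=> x _; exact: powR_ge0.
Qed.

Lemma modular_subset f A B : measurable A -> measurable B ->
  measurable_fun setT f -> A `<=` B -> modular f A <= modular f B.
Proof.
move=> mA mB mf AB; apply: ge0_subset_integral => //.
- by apply/measurable_EFinP; exact: measurable_powRp.
- by move=> x _; rewrite lee_fin powR_ge0.
Qed.

Lemma modular_setID f A B : measurable A -> measurable B ->
  measurable_fun setT f -> modular f A = modular f (A `&` B) + modular f (A `\` B).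
Proof.
move=> mA mB mf; rewrite /modular -ge0_integral_setU//.
- by rewrite setUIDK.
- exact: measurableI.
- exact: measurableD.
- by rewrite setUIDK; apply/measurable_EFinP; exact: measurable_powRp.
- by move=> x _; rewrite lee_fin powR_ge0.
- by apply/disj_setPLR => x [_ Bx] [].
Qed.

Lemma luxemburg_restrict f S : measurable S -> (forall x, 0 <= f x)%R ->
  luxemburg (f \* \1_S)%R =
  ereal_inf [set l%:E | l in [set l : R | (0 < l)%R /\
     modular (fun x => f x / l)%R S <= 1]].
Proof.
move=> mS f0.
have E l : (0 < l)%R ->
    \int[mu]_x (`|(f \* \1_S)%R x / l| `^ p x)%:E = modular (fun x => f x / l)%R S.
  move=> l0; rewrite /modular [RHS]integral_mkcond; apply: eq_integral => x _ /=.
  rewrite patchE indicE; case: ifPn => xS /=.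
    by rewrite mulr1 ger0_norm// divr_ge0// ltW.
  rewrite mulr0 mul0r normr0 powR0// gt_eqF//.
  by have /andP[+ _] := p1 x; apply: lt_le_trans.
rewrite /luxemburg; apply: (f_equal (fun A => ereal_inf [set l%:E | l in A])).
apply: eq_set => l; apply: propext.
by split => -[l0]; [rewrite (E l l0)|rewrite -(E l l0)]; split.
Qed.

Lemma powR_dilate (a t q : R) : (0 <= a -> 1 <= t -> q <= P ->
  (a * t) `^ q <= t `^ P * a `^ q)%R.
Proof.
move=> a0 t1 qP; rewrite powRM//; last by rewrite (le_trans _ t1).
by rewrite mulrC ler_wpM2r// ?powR_ge0// ler_powR.
Qed.

Let root_gt1 (e : R) : (0 < e)%R -> exists t : R, (1 < t)%R /\ (t `^ P = 1 + e)%R.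
Proof.
move=> e0; exists ((1 + e) `^ P^-1)%R.
have P0 : (0 < P)%R by apply: lt_le_trans P1.
split; last by rewrite -powRrM mulVf ?gt_eqF// powRr1//; lra.
have -> : (1 = 1 `^ P^-1 :> R)%R by rewrite powR1.
by apply: gt0_ltr_powR; rewrite ?nnegrE ?invr_gt0 ?powR1; lra.
Qed.

Lemma modular_monotone f S (l l' : R) : measurable S -> measurable_fun setT f ->
  (forall x, 0 <= f x)%R -> (0 < l)%R -> (l <= l')%R ->
  modular (fun x => f x / l')%R S <= modular (fun x => f x / l)%R S.
Proof.
move=> mS mf f0 l0 ll'; rewrite -[leRHS]mul1e; apply: modular_le => //.
- exact: measurable_funM.
- exact: measurable_funM.
move=> x _; rewrite mul1r; apply: ge0_ler_powR.
- by have /andP[h _] := p1 x; apply: le_trans h.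
- by rewrite nnegrE divr_ge0//; lra.
- by rewrite nnegrE divr_ge0//; lra.
- by rewrite ler_wpM2l// lef_pV2 ?posrE//; lra.
Qed.

Lemma modular_dilate f S (l t : R) : measurable S -> measurable_fun setT f ->
  (forall x, 0 <= f x)%R -> (0 < l)%R -> (1 <= t)%R ->
  modular (fun x => f x / l)%R S <=
    (t `^ P)%:E * modular (fun x => f x / (l * t))%R S.
Proof.
move=> mS mf f0 l0 t1; apply: modular_le => //.
- exact: measurable_funM.
- exact: measurable_funM.
- exact: powR_ge0.
move=> x _; rewrite (_ : f x / l = f x / (l * t) * t)%R; last first.
  by rewrite invfM mulrA divfK// gt_eqF//; lra.
apply: powR_dilate => //; first by rewrite divr_ge0// mulr_ge0//; lra.
by have /andP[] := p1 x.
Qed.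

(** For every t > 1 some l < N t has modular at most 1, and replacing N t by N
    multiplies the modular by at most t ^ P; let t tend to 1. *)
Lemma modular_norm_le1 f S (N : R) : measurable S -> measurable_fun setT f ->
  (forall x, 0 <= f x)%R -> (0 < N)%R -> luxemburg (f \* \1_S)%R <= N%:E ->
  modular (fun x => f x / N)%R S <= 1.
Proof.
move=> mS mf f0 N0; rewrite luxemburg_restrict// => eN.
apply/lee_addgt0Pr => e e0; have [t [t1 tP]] := root_gt1 e0.
apply: (le_trans (modular_dilate mS mf f0 N0 (ltW t1))).
rewrite tP -EFinD -[leRHS]mule1 lee_pmul2l ?lte_fin//; last lra.
have : ereal_inf [set l%:E | l in [set l : R | (0 < l)%R /\
     modular (fun x => f x / l)%R S <= 1]] < (N * t)%:E.
  by apply: (le_lt_trans eN); rewrite lte_fin ltr_pMr.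
move=> /ereal_inf_lt[_ [l [l0 hl] <-]]; rewrite lte_fin => lN.
by apply: le_trans hl; apply: modular_monotone => //; exact: ltW.
Qed.

Lemma modular_norm_ge1 f S (M : R) : measurable S -> measurable_fun setT f ->
  (forall x, 0 <= f x)%R -> (0 < M)%R -> M%:E <= luxemburg (f \* \1_S)%R ->
  1 <= modular (fun x => f x / M)%R S.
Proof.
move=> mS mf f0 M0; rewrite luxemburg_restrict// => MN.
rewrite leNgt; apply/negP => m1.
have mfin : modular (fun x => f x / M)%R S \is a fin_num.
  by rewrite ge0_fin_numE ?modular_ge0//; apply: lt_trans m1 _; rewrite ltry.
set m := modular _ _ in m1 mfin.
have m0 : (0 <= fine m)%R by rewrite fine_ge0// modular_ge0.
have m1' : (fine m < 1)%R by rewrite -lte_fin fineK.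
have e0 : (0 < (1 - fine m) / 2)%R by lra.
have [t [t1 tP]] := root_gt1 e0.
have Mt0 : (0 < M / t)%R by rewrite divr_gt0//; lra.
have : (M / t)%:E < M%:E.
  by rewrite lte_fin ltr_pdivrMr ?ltr_pMr//; lra.
move=> /lt_le_trans /(_ MN); rewrite ltNge => /negP; apply.
apply: ereal_inf_lbound; exists (M / t)%R; last by [].
split; first exact: Mt0.
apply: (le_trans (modular_dilate mS mf f0 Mt0 (ltW t1))).
rewrite divfK ?gt_eqF//; last lra.
by rewrite -/m tP -(fineK mfin) -EFinM lee_fin; nra.
Qed.

Lemma luxemburg_le f S (N : R) : measurable S -> (forall x, 0 <= f x)%R -> (0 < N)%R ->
  modular (fun x => f x / N)%R S <= 1 -> luxemburg (f \* \1_S)%R <= N%:E.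
Proof.
by move=> mS f0 N0 h; rewrite luxemburg_restrict//; apply: ereal_inf_lbound; exists N.
Qed.

Lemma luxemburg_ge0 f : 0 <= luxemburg f.
Proof. by apply: le_ereal_inf_tmp => _ [l [l0 _] <-]; rewrite lee_fin ltW. Qed.

Lemma luxemburg_subset f A B : measurable A -> measurable B ->
  measurable_fun setT f -> (forall x, 0 <= f x)%R -> A `<=` B ->
  luxemburg (f \* \1_A)%R <= luxemburg (f \* \1_B)%R.
Proof.
move=> mA mB mf f0 AB; rewrite (luxemburg_restrict mA f0) (luxemburg_restrict mB f0).
apply: le_ereal_inf_tmp => _ [l [l0 hl] <-].
apply: ereal_inf_lbound; exists l; last by [].
split; first exact: l0.
apply: le_trans hl; apply: modular_subset => //.
exact: measurable_funM.
Qed.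

(** As p >= 1, the number (1 / l) ^ p is at most 1 / l for l >= 1 and at least 1 / l
    for l <= 1: hence max 1 |Q| is admissible, and nothing below min 1 |Q| / 2 is. *)
Lemma luxemburg_indic_bounds (Q : set T) (v : R) : measurable Q ->
  (0 < v)%R -> mu Q = v%:E -> exists2 L : R, (0 < L)%R &
  luxemburg \1_Q = L%:E.
Proof.
move=> mQ v0 eQ.
have -> : (\1_Q : T -> R) = (cst 1%R \* \1_Q)%R.
  by apply/funext => x /=; rewrite mul1r.
have one0 (x : T) : (0 <= cst 1 x :> R)%R by [].
have up : luxemburg (cst 1%R \* \1_Q)%R <= (Num.max 1 v)%:E.
  have m1 : (1 <= Num.max 1 v)%R by rewrite le_max lexx.
  have vm : (v <= Num.max 1 v)%R by rewrite le_max lexx orbT.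
  apply: luxemburg_le => //; first lra.
  have : modular (fun x => cst 1 x / Num.max 1 v)%R Q <=
      ((Num.max 1 v)^-1)%:E * \int[mu]_(x in Q) (cst 1%R x)%:E.
    apply: ge0_le_integralZ => //.
    - by apply: measurable_powRp => //; apply: measurable_funM; exact: measurable_cst.
    - by rewrite invr_ge0; lra.
    - by move=> x _; exact: powR_ge0.
    move=> x _; rewrite /= mul1r mulr1; apply: ge1r_powR.
      by rewrite invr_gt0 invf_le1; lra.
    by have /andP[] := p1 x.
  move=> /le_trans; apply.
  rewrite [X in _ * X](integral_cst mu mQ 1) mul1e eQ -EFinM lee_fin mulrC ler_pdivrMr; lra.
have lo : (Num.min 1 v / 2)%:E <= luxemburg (cst 1%R \* \1_Q)%R.
  have m1 : (Num.min 1 v <= 1)%R by rewrite ge_min lexx.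
  have vm : (Num.min 1 v <= v)%R by rewrite ge_min lexx orbT.
  have m0 : (0 < Num.min 1 v)%R by rewrite lt_min ltr01.
  rewrite luxemburg_restrict//; apply: le_ereal_inf_tmp => _ [l [l0 hl] <-].
  rewrite lee_fin leNgt; apply/negP => lv.
  move: hl; apply/negP; rewrite -ltNge.
  have : \int[mu]_(x in Q) (l^-1)%:E <= 1%:E * modular (fun x => cst 1 x / l)%R Q.
    apply: ge0_le_integralZ => //.
    - by apply: measurable_powRp => //; apply: measurable_funM; exact: measurable_cst.
    - by move=> x _; rewrite invr_ge0 ltW.
    - by move=> x _; exact: powR_ge0.
    move=> x _; rewrite /= !mul1r; apply: le1r_powR.
      by rewrite -invf_le1 ?invrK ?invr_gt0//; lra.
    by have /andP[] := p1 x.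
  rewrite mul1e; apply: lt_le_trans.
  by rewrite (integral_cst mu mQ) eQ -EFinM lte_fin mulrC ltr_pdivlMr; lra.
move: up lo; case: luxemburg => [L| |] //=; rewrite !lee_fin => _ lo; exists L => //.
apply: lt_le_trans lo; rewrite divr_gt0// lt_min ltr01//.
Qed.

End luxemburg.

(** * Mean oscillation of a logarithm *)

Lemma integrable_cst_fin d (T : measurableType d) (R : realType)
    (mu : {measure set T -> \bar R}) (Q : set T) (k : R) :
  measurable Q -> mu Q < +oo -> mu.-integrable Q (EFin \o (fun=> k)).
Proof.
move=> mQ Qoo; apply/integrableP; split; first exact/measurable_EFinP.
under eq_integral do rewrite /=.
by rewrite (integral_cst mu mQ) lte_mul_pinfty// lee_fin.
Qed.

Section log_mean.
Context {d : measure_display} {T : measurableType d} {R : realType}.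
Variable mu : {measure set T -> \bar R}.
Local Open Scope ring_scope.

Definition mean (Q : set T) (f : T -> R) : R :=
  (\int[mu]_(x in Q) f x) / fine (mu Q).

Variables (Q : set T).
Hypotheses (mQ : measurable Q) (Q0 : 0 < fine (mu Q)).
Local Notation intble f := (mu.-integrable Q (EFin \o f)).

Let Qfin : (mu Q < +oo)%E.
Proof. by move: Q0; case: (mu Q) => [v _||]; rewrite ?ltxx ?ltry. Qed.

Lemma intble_cst (k : R) : intble (fun=> k).
Proof. exact: integrable_cst_fin. Qed.

Lemma intbleD (f g : T -> R) : intble f -> intble g -> intble (fun x => f x + g x).
Proof.
move=> hf hg; have := integrableD mQ hf hg.
by apply: eq_integrable.
Qed.

Lemma intbleZ (k : R) (f : T -> R) : intble f -> intble (fun x => k * f x).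
Proof.
move=> hf; have := integrableZl mQ k hf.
by apply: eq_integrable.
Qed.

Lemma mean_cst (k : R) : mean Q (fun=> k) = k.
Proof. by rewrite /mean Rintegral_cst// mulfK// gt_eqF. Qed.

Lemma meanD (f g : T -> R) : intble f -> intble g ->
  mean Q (fun x => f x + g x) = mean Q f + mean Q g.
Proof. by move=> hf hg; rewrite /mean RintegralD// mulrDl. Qed.

Lemma meanZ (k : R) (f : T -> R) : intble f ->
  mean Q (fun x => k * f x) = k * mean Q f.
Proof. by move=> hf; rewrite /mean RintegralZl// mulrA. Qed.

Lemma le_mean (f g : T -> R) : intble f -> intble g ->
  (forall x, Q x -> f x <= g x) -> mean Q f <= mean Q g.
Proof.
move=> hf hg fg; rewrite /mean; apply: ler_wpM2r.
  by rewrite invr_ge0 ltW.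
exact: le_Rintegral.
Qed.

Lemma intble_abs_sub (f : T -> R) (a : R) : intble f -> intble (fun x => `|f x - a|).
Proof. by move=> hf; apply: integrable_norm; apply: intbleD => //; exact: intble_cst. Qed.

Variable L : T -> R.
Hypotheses (iL : intble L) (iE : intble (fun x => expR (L x))).

(** Jensen's inequality for the exponential, from the tangent line at mean Q L. *)
Lemma exp_mean_le : expR (mean Q L) <= mean Q (fun x => expR (L x)).
Proof.
set g := mean Q L.
have -> : expR g = mean Q (fun x => expR g * (L x + (1 - g))).
  rewrite meanZ ?meanD ?mean_cst//; try exact: intble_cst.
    by rewrite -/g addrC subrK mulr1.
  by apply: intbleD => //; exact: intble_cst.
apply: le_mean => //.
  by apply: intbleZ; apply: intbleD => //; exact: intble_cst.
move=> x _; have -> : expR (L x) = expR g * expR (L x - g).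
  by rewrite -expRD addrC subrK.
rewrite ler_pM2l ?expR_gt0//; apply: le_trans (expR_ge1Dx _).
lra.
Qed.

(** If the arithmetic mean m of exp L exceeds its geometric mean by a bounded
    factor, then L has bounded mean oscillation: the positive part of L - ln m
    is at most exp (L - ln m), of mean 1, and the mean of L - ln m
    is bounded below. *)
Lemma mean_abs_le (m : R) : 0 < m -> mean Q (fun x => expR (L x)) = m ->
  mean Q (fun x => `|L x - ln m|) <= 2 - (mean Q L - ln m).
Proof.
move=> m0 em.
have iL' : intble (fun x => (-1) * L x + ln m).
  by apply: intbleD; [exact: intbleZ|exact: intble_cst].
have -> : 2 - (mean Q L - ln m) =
    mean Q (fun x => 2 / m * expR (L x) + ((-1) * L x + ln m)).
  rewrite meanD//; last exact: intbleZ.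
  rewrite meanD//; [|exact: intbleZ|exact: intble_cst].
  by rewrite !meanZ// mean_cst em; field; rewrite gt_eqF.
apply: le_mean.
- exact: intble_abs_sub.
- by apply: intbleD => //; exact: intbleZ.
move=> x _.
have -> : 2 / m * expR (L x) = 2 * expR (L x - ln m).
  by rewrite expRB lnK ?posrE// mulrA mulrAC.
have h1 := @expR_ge1Dx R (L x - ln m); have h0 := @expR_ge0 R (L x - ln m).
by rewrite ler_norml; apply/andP; split; lra.
Qed.

(** Write L = a + (L - a) and bound p by P on the second term. *)
Lemma mean_weighted_ge (p : T -> R) (P a : R) : measurable_fun setT p ->
  (forall x, 0 <= p x <= P) ->
  intble (fun x => p x * L x) /\
  mean Q p * a - P * mean Q (fun x => `|L x - a|) <= mean Q (fun x => p x * L x).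
Proof.
move=> mp p0.
have mpQ : measurable_fun Q p by exact: measurable_funS mp.
have ip : intble p.
  apply: (le_integrable mQ _ _ (intble_cst P)).
    exact/measurable_EFinP.
  move=> x _; rewrite /= lee_fin; have /andP[h1 h2] := p0 x.
  by rewrite !ger0_norm//; lra.
have ipL : intble (fun x => p x * L x).
  apply: (le_integrable mQ _ _ (intbleZ P (integrable_norm iL))).
    apply/measurable_EFinP; apply: measurable_funM => //.
    by apply/measurable_EFinP; exact: (measurable_int mu iL).
  move=> x _; rewrite /= lee_fin !normrM normr_id.
  have /andP[h1 h2] := p0 x.
  by rewrite ler_wpM2r// !ger0_norm//; lra.
split => //.
have -> : mean Q p * a - P * mean Q (fun x => `|L x - a|) =
    mean Q (fun x => a * p x + (- P) * `|L x - a|).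
  rewrite meanD; [|exact: intbleZ|by apply: intbleZ; exact: intble_abs_sub].
  rewrite !meanZ//; last exact: intble_abs_sub.
  by rewrite mulNr mulrC.
apply: le_mean => //.
  by apply: intbleD; [exact: intbleZ|apply: intbleZ; exact: intble_abs_sub].
move=> x _; have /andP[h1 h2] := p0 x.
have : - `|L x - a| <= L x - a by rewrite lerNl -normrN ler_norm.
have : 0 <= `|L x - a| by [].
nra.
Qed.

Lemma mean_subset (Q' : set T) (a : R) : measurable Q' -> Q' `<=` Q ->
  0 < fine (mu Q') ->
  `|mean Q' L - a| <= fine (mu Q) / fine (mu Q') * mean Q (fun x => `|L x - a|).
Proof.
move=> mQ' sQ v0.
have iL' : mu.-integrable Q' (EFin \o L) by exact: integrableS iL.
have fQ' : (mu Q' < +oo)%E by apply: le_lt_trans Qfin; apply: le_measure; rewrite ?inE.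
have ic' : mu.-integrable Q' (EFin \o (fun=> a)) by exact: integrable_cst_fin.
have iLa : mu.-integrable Q' (EFin \o (fun x => L x - a)).
  have := integrableB mQ' iL' ic'.
  by apply: eq_integrable.
have -> : mean Q' L - a = mean Q' (fun x => L x - a).
  rewrite /mean RintegralB// Rintegral_cst// mulrBl mulfK// gt_eqF//.
rewrite [X in _ <= X]mulrC mulrA /mean divfK ?gt_eqF// normrM.
rewrite [`|_^-1|]ger0_norm ?invr_ge0 ?(ltW v0)//; apply: ler_wpM2r.
  by rewrite invr_ge0 ltW.
apply: le_trans (le_normr_Rintegral mQ' iLa) _.
have iabs : intble (fun x => `|L x - a|) by exact: intble_abs_sub.
rewrite -lee_fin /Rintegral !fineK; last 2 first.
- exact: (integrable_fin_num mQ iabs).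
- exact: (integrable_fin_num mQ' (integrable_norm iLa)).
apply: ge0_subset_integral => //.
exact: (measurable_int mu iabs).
Qed.

End log_mean.

(** * Large subsets under a reverse Hoelder inequality *)

Lemma inv_powR (R : realType) (a q : R) : (0 <= a)%R -> (a^-1 `^ q = (a `^ q)^-1)%R.
Proof. by move=> a0; rewrite -powR_inv1// -powRrM mulN1r powRN. Qed.

(** Hoelder's inequality on F, in the form needed after a reverse Hoelder
    inequality with constant 2 on Q: a subset of small relative measure carries
    a small part of the integral of w. *)
Lemma small_set_mass d (T : measurableType d) (R : realType)
    (mu : {measure set T -> \bar R}) (Q F : set T) (w : T -> R)
    (v m delta alpha : R) :
  measurable Q -> measurable F -> F `<=` Q ->
  measurable_fun setT w -> (forall x, 0 <= w x)%R ->
  (0 < v)%R -> (0 < m)%R -> (1 < delta)%R -> (0 < alpha)%R ->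
  \int[mu]_(x in Q) (w x `^ delta)%:E <= (v * (2 * m) `^ delta)%:E ->
  mu F <= (alpha * v)%:E ->
  \int[mu]_(x in F) (w x)%:E <= (2 * alpha `^ (1 - delta^-1) * (m * v))%:E.
Proof.
move=> mQ mF FQ mw w0 v0 m0 d1 a0 hQ hF.
have d0 : (0 < delta)%R by apply: lt_trans d1.
(* X and Y bound the L^delta norm of w on F and the norm of 1 in the conjugate
   space; Young's inequality is applied to w / X and 1 / Y. *)
pose X : R := (v `^ delta^-1 * (2 * m))%R.
pose y : R := (alpha * v)%R.
have y0 : (0 < y)%R by rewrite mulr_gt0.
have q0 : (0 < 1 - delta^-1)%R by rewrite subr_gt0 invf_lt1.
pose Y : R := (y `^ (1 - delta^-1))%R.
have X0 : (0 < X)%R by rewrite mulr_gt0 ?powR_gt0// mulr_gt0.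
have Y0 : (0 < Y)%R by rewrite powR_gt0.
have Xd : (X `^ delta = v * (2 * m) `^ delta)%R.
  rewrite /X [LHS]powRM ?powR_ge0//; last lra.
  by rewrite -powRrM mulVf ?gt_eqF// powRr1// ltW.
have XY : (X * Y = 2 * alpha `^ (1 - delta^-1) * (m * v))%R.
  rewrite /X /Y /y powRM ?(ltW a0) ?(ltW v0)//.
  have ev : (v `^ delta^-1 * v `^ (1 - delta^-1) = v)%R.
    rewrite -powRD; last by rewrite (gt_eqF v0) implybT.
    by rewrite addrCA subrr addr0 powRr1// ltW.
  by rewrite -[in RHS]ev; ring.
have mwd : measurable_fun F (fun x => w x `^ delta)%R.
  apply: (@measurableT_comp _ _ _ _ _ _ (fun t : R => t `^ delta)%R).
    exact: measurable_powR.
  exact: measurable_funS mw.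
have young x : (w x <= X * Y * (delta^-1 * (X `^ delta)^-1 * (w x `^ delta)
     + (1 - delta^-1) * y^-1))%R.
  have := @conjugate_powR R (w x / X)%R (Y^-1)%R delta ((1 - delta^-1)^-1)%R.
  rewrite invrK addrCA subrr addr0 => /(_ _ _ _ _ erefl) h.
  rewrite -(ler_pdivrMl _ _ (mulr_gt0 X0 Y0)).
  rewrite (_ : (X * Y)^-1 * w x = w x / X * Y^-1)%R; last first.
    by rewrite invfM mulrC mulrA.
  apply: le_trans (h _ _ _ _) _.
  - by rewrite divr_ge0// ltW.
  - by rewrite invr_ge0 ltW.
  - exact: d0.
  - by rewrite invr_gt0.
  apply: lerD.
    rewrite powRM ?invr_ge0 ?(ltW X0)//.
    by rewrite inv_powR ?(ltW X0)// [leRHS]mulrC mulrA mulrAC.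
  rewrite mulrC ler_wpM2l ?(ltW q0)//.
  by rewrite inv_powR ?(ltW Y0)// /Y -powRrM divff ?gt_eqF// powRr1// ltW.
apply: (@le_trans _ _ (\int[mu]_(x in F)
  ((X * Y)%:E * ((delta^-1 * (X `^ delta)^-1)%:E * (w x `^ delta)%:E
     + ((1 - delta^-1) * y^-1)%:E)))).
  apply: ge0_le_integral => //.
  - by move=> x _; rewrite lee_fin.
  - by apply/measurable_EFinP; exact: measurable_funS mw.
  - apply: measurable_funeM; apply: emeasurable_funD.
      by apply: measurable_funeM; exact/measurable_EFinP.
    exact: measurable_cst.
  - by move=> x _; have := young x; rewrite -lee_fin.
have c0 : (0 <= delta^-1 * (X `^ delta)^-1)%R.
  by rewrite mulr_ge0// invr_ge0 ?powR_ge0// ltW.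
have c1 : (0 <= (1 - delta^-1) * y^-1)%R.
  by rewrite mulr_ge0// ?invr_ge0 ltW.
have mc : measurable_fun F
   (fun x => (delta^-1 * (X `^ delta)^-1)%:E * (w x `^ delta)%:E).
  by apply: measurable_funeM; exact/measurable_EFinP.
have g0 x : F x -> 0 <= (delta^-1 * (X `^ delta)^-1)%:E * (w x `^ delta)%:E.
  by move=> _; rewrite -EFinM lee_fin mulr_ge0// powR_ge0.
have g1 x : F x -> 0 <= ((1 - delta^-1) * y^-1)%:E by move=> _; rewrite lee_fin.
have mk : measurable_fun F (fun _ : T => ((1 - delta^-1) * y^-1)%:E).
  exact: measurable_cst.
have wd0 x : F x -> 0 <= (w x `^ delta)%:E by move=> _; rewrite lee_fin powR_ge0.
have mwd' : measurable_fun F (fun x => (w x `^ delta)%:E) by exact/measurable_EFinP.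
have XY00 : (0 < X * Y)%R by exact: mulr_gt0.
have XY0 : (0 <= X * Y)%R by rewrite ltW// mulr_gt0.
rewrite (ge0_integralZl_EFin mu mF _ (emeasurable_funD mc mk) XY0); last first.
  by move=> x Fx; apply: adde_ge0; [exact: g0|exact: (g1 x)].
rewrite (ge0_integralD mu mF g0 mc g1 mk).
rewrite (ge0_integralZl_EFin mu mF wd0 mwd' c0).
rewrite (integral_cst mu mF) -XY -[leRHS]mule1 lee_pmul2l ?lte_fin//.
have -> : 1 = (delta^-1)%:E + (1 - delta^-1)%:E :> \bar R.
  by rewrite -EFinD addrCA subrr addr0.
apply: leeD.
  apply: (@le_trans _ _ ((delta^-1 * (X `^ delta)^-1)%:E * (X `^ delta)%:E)).
    apply: lee_wpmul2l; first by rewrite lee_fin.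
    rewrite Xd; apply: le_trans hQ; apply: ge0_subset_integral => //.
      apply/measurable_EFinP; apply: (@measurableT_comp _ _ _ _ _ _ (fun t : R => t `^ delta)%R).
        exact: measurable_powR.
      exact: measurable_funS mw.
    by move=> x _; rewrite lee_fin powR_ge0.
  by rewrite -EFinM lee_fin divfK// gt_eqF// powR_gt0.
apply: (@le_trans _ _ (((1 - delta^-1) * y^-1)%:E * y%:E)).
  by apply: lee_wpmul2l.
by rewrite -EFinM lee_fin divfK// gt_eqF.
Qed.

Lemma large_set_mass d (T : measurableType d) (R : realType)
    (mu : {measure set T -> \bar R}) (Q E : set T) (w : T -> R)
    (v m delta alpha : R) :
  measurable Q -> measurable E -> E `<=` Q ->
  measurable_fun setT w -> (forall x, 0 <= w x)%R ->
  (0 < v)%R -> (0 < m)%R -> (1 < delta)%R -> (0 < alpha)%R ->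
  mu Q = v%:E ->
  \int[mu]_(x in Q) (w x)%:E = (m * v)%:E ->
  ((v^-1)%:E * \int[mu]_(x in Q) (w x `^ delta)%:E) `^ delta^-1 <= (2 * m)%:E ->
  (1 - alpha)%:E * v%:E < mu E ->
  ((1 - 2 * alpha `^ (1 - delta^-1)) * (m * v))%:E <= \int[mu]_(x in E) (w x)%:E.
Proof.
move=> mQ mE EQ mw w0 v0 m0 d1 a0 Qv Qw rh hE.
have d0 : (0 < delta)%R by apply: lt_trans d1.
have mF : measurable (Q `\` E) by exact: measurableD.
have hQ : \int[mu]_(x in Q) (w x `^ delta)%:E <= (v * (2 * m) `^ delta)%:E.
  have I0 : 0 <= \int[mu]_(x in Q) (w x `^ delta)%:E.
    by apply: integral_ge0 => x _; rewrite lee_fin powR_ge0.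
  have vI0 : 0 <= (v^-1)%:E * \int[mu]_(x in Q) (w x `^ delta)%:E.
    by rewrite mule_ge0// lee_fin invr_ge0 ltW.
  have := @gt0_ler_poweR R delta (ltW d0) _ _ _ _ rh.
  rewrite -poweRrM mulVf ?gt_eqF// poweRe1// poweR_EFin => h.
  rewrite EFinM -lee_pdivrMl//; apply: h.
    by rewrite in_itv/= poweR_ge0 leey.
  by rewrite in_itv/= lee_fin leey andbT mulr_ge0// ltW.
have hF : mu (Q `\` E) <= (alpha * v)%:E.
  have EQ' : Q `&` E = E by rewrite setIC; apply/setIidl.
  have : mu Q = mu (Q `&` E) + mu (Q `\` E).
    by rewrite addeC -measureDI.
  have Eoo : mu E < +oo.
    apply: (@le_lt_trans _ _ (mu Q)); last by rewrite Qv ltry.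
    by apply: le_measure; rewrite ?inE.
  rewrite EQ' Qv; move: hE Eoo; have := measure_ge0 mu E; have := measure_ge0 mu (Q `\` E).
  case: (mu E) => [e||]//; case: (mu (Q `\` E)) => [f||]// _ _.
  rewrite -EFinM !lte_fin => h _ [h']; rewrite lee_fin; lra.
have mwQ : measurable_fun Q (fun x => (w x)%:E).
  by apply/measurable_EFinP; exact: measurable_funS mw.
have FS := small_set_mass mQ mF (@subDsetl _ Q E) mw w0 v0 m0 d1 a0 hQ hF.
have : \int[mu]_(x in Q) (w x)%:E =
    \int[mu]_(x in E) (w x)%:E + \int[mu]_(x in Q `\` E) (w x)%:E.
  rewrite -ge0_integral_setU//.
  - by rewrite setDUK.
  - by rewrite setDUK.
  - by move=> x _; rewrite lee_fin.
  - by apply/disj_setPLR => x Ex [].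
rewrite Qw; move: FS.
have I1 : 0 <= \int[mu]_(x in E) (w x)%:E by apply: integral_ge0 => x _; rewrite lee_fin.
have I2 : 0 <= \int[mu]_(x in Q `\` E) (w x)%:E by apply: integral_ge0 => x _; rewrite lee_fin.
move: I1 I2; case: (\int[mu]_(x in E) _) => [e||]//; case: (\int[mu]_(x in _) _) => [f||]//.
by rewrite !lee_fin => _ _ h [h']; lra.
Qed.

(** * A weight with finite A_{p,oo} quotient on one set *)

Lemma ln_inv (R : realType) (a : R) : ln a^-1 = (- ln a)%R.
Proof.
have [a0|a0] := ltP 0%R a; first by rewrite lnV.
by rewrite !ln0 ?oppr0// invr_le0.
Qed.

Section weight_on_set.
Context {d : measure_display} {T : measurableType d} {R : realType}.
Variables (mu : {measure set T -> \bar R}) (Q : set T) (v : R).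
Hypotheses (mQ : measurable Q) (v0 : (0 < v)%R) (Qv : mu Q = v%:E).
Variable w : T -> R.
Hypotheses (mw : measurable_fun setT w) (w0 : forall x, (0 <= w x)%R).
Hypothesis wpos : {ae mu, forall x, (0 < w x)%R}.

Let mwQ : measurable_fun Q w. Proof. exact: measurable_funS mw. Qed.

(* As ln 0 = 0, the two functions differ where w vanishes. *)
Lemma ae_exp_ln : ae_eq mu Q (fun x => (w x)%:E) (fun x => (expR (ln (w x)))%:E).
Proof. by apply: filterS wpos => x wx _; rewrite lnK. Qed.

Lemma measurable_lnw : measurable_fun Q (fun x => ln (w x)).
Proof. exact: (@measurableT_comp _ _ _ _ _ _ (@ln R)). Qed.

Lemma integral_exp_ln :
  \int[mu]_(x in Q) (expR (ln (w x)))%:E = \int[mu]_(x in Q) (w x)%:E.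
Proof.
have mE : measurable_fun Q (fun x => (expR (ln (w x)))%:E).
  apply/measurable_EFinP; apply: (@measurableT_comp _ _ _ _ _ _ (@expR R)) => //.
  exact: measurable_lnw.
have mw' : measurable_fun Q (fun x => (w x)%:E) by exact/measurable_EFinP.
have E0 x : Q x -> 0 <= (expR (ln (w x)))%:E by move=> _; rewrite lee_fin expR_ge0.
have w0' x : Q x -> 0 <= (w x)%:E by move=> _; rewrite lee_fin.
apply: (ge0_ae_eq_integral mQ mE mw' E0 w0').
by apply: filterS ae_exp_ln => x h Qx; rewrite h.
Qed.

Lemma expe_mean_ln_inv : mu.-integrable Q (EFin \o (fun x => ln (w x))) ->
  expeR ((v^-1)%:E * \int[mu]_(x in Q) (ln (w x)^-1)%:E) =
  (expR (- mean mu Q (fun x => ln (w x))))%:E.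
Proof.
move=> iL.
have -> : \int[mu]_(x in Q) (ln (w x)^-1)%:E =
    - \int[mu]_(x in Q) (ln (w x))%:E.
  rewrite -integralN; last exact: integrable_add_def.
  by apply: eq_integral => x _; rewrite ln_inv.
rewrite /mean Qv /= /Rintegral -[X in - X]fineK; last exact: (integrable_fin_num mQ iL).
by rewrite -EFinN -EFinM /= mulrN mulrC.
Qed.

Lemma integrable_ge0_lty (f : T -> R) : measurable_fun Q f ->
  (forall x, Q x -> 0 <= f x)%R -> \int[mu]_(x in Q) (f x)%:E < +oo ->
  mu.-integrable Q (EFin \o f).
Proof.
move=> mf f0 foo; apply/integrableP; split; first exact/measurable_EFinP.
rewrite (eq_integral (fun x => (f x)%:E))// => x; rewrite inE => Qx.
by rewrite /= ger0_norm// f0.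
Qed.

(** The positive part of ln w is at most w, and a divergent negative part would make
    the geometric mean of 1 / w infinite. *)
Lemma integrable_lnw : \int[mu]_(x in Q) (w x)%:E < +oo ->
  expeR ((v^-1)%:E * \int[mu]_(x in Q) (ln (w x)^-1)%:E) != +oo ->
  mu.-integrable Q (EFin \o (fun x => ln (w x))).
Proof.
move=> Iw; rewrite expeR_eqy => h.
pose f x := (ln (w x)^-1)%:E.
have mf : measurable_fun Q f.
  apply/measurable_EFinP.
  rewrite (_ : (fun x => ln (w x)^-1) = (fun x => - ln (w x))%R); last first.
    by apply/funext => x; rewrite ln_inv.
  by apply: measurableT_comp => //; exact: measurable_lnw.
have fneg : \int[mu]_(x in Q) f^\- x < +oo.
  apply: le_lt_trans Iw; apply: ge0_le_integral => //.
  - exact: measurable_funeneg.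
  - exact/measurable_EFinP.
  - move=> x _; rewrite funenegE /f ln_inv EFinN oppeK ge_max !lee_fin w0 andbT.
    have := w0 x; rewrite le_eqVlt => /predU1P[<-|wx]; first by rewrite ln0.
    exact/ltW/ln_sublinear.
have fpos : \int[mu]_(x in Q) f^\+ x < +oo.
  rewrite ltey; apply/eqP => fy; move: h.
  rewrite -/f integralE fy addye; last first.
    by apply/eqP => /(congr1 (fun x => - x)); rewrite oppeK /= => e; rewrite e ltxx in fneg.
  by rewrite mulry gtr0_sg ?invr_gt0// mul1e eqxx.
have fi : mu.-integrable Q f.
  apply/integrableP; split => //.
  rewrite (_ : (fun x => `|f x|) = (fun x => f^\+ x + f^\- x)); last first.
    by apply/funext => x; rewrite -[LHS]/((abse \o f) x) fune_abse.
  rewrite ge0_integralD//; first by rewrite lte_add_pinfty.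
  - exact: measurable_funepos.
  - exact: measurable_funeneg.
have := integrableN fi; apply: eq_integrable => // x _.
by rewrite /f /= ln_inv opprK.
Qed.

Lemma integrable_exp_ln : mu.-integrable Q (EFin \o w) ->
  mu.-integrable Q (EFin \o (fun x => expR (ln (w x)))).
Proof.
move=> iw; apply: integrable_ge0_lty.
- by apply: measurableT_comp => //; exact: measurable_lnw.
- by move=> x _; exact: expR_ge0.
rewrite integral_exp_ln -ge0_fin_numE; first exact: (integrable_fin_num mQ iw).
by apply: integral_ge0 => x _; rewrite lee_fin.
Qed.

(** As [mul_infty] gives oo even for oo * 0, a finite A_{p,oo} quotient forces both
    the norm N and the geometric mean of 1 / w to be finite. *)
Lemma weight_on_set_bounds (Lam K c : R) (N : \bar R) :
  (0 < Lam)%R -> (0 < K)%R -> 0 <= N ->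
  (v^-1)%:E * \int[mu]_(x in Q) (w x)%:E <= K%:E * (Lam^-1%:E * N) ->
  mul_infty (Lam^-1%:E * N)
    (expeR ((v^-1)%:E * \int[mu]_(x in Q) (ln (w x)^-1)%:E)) <= c%:E ->
  [/\ N = (fine N)%:E, (0 < fine N)%R,
      mu.-integrable Q (EFin \o w) /\ mu.-integrable Q (EFin \o (fun x => ln (w x))),
      (expR (mean mu Q (fun x => ln (w x))) <= mean mu Q w)%R /\
      (mean mu Q w <= K * (fine N / Lam))%R &
      (fine N <= c * Lam * expR (mean mu Q (fun x => ln (w x))))%R].
Proof.
move=> L0 K0 N0 h1; rewrite /mul_infty; case: ifPn => [_|]; first by rewrite leye_eq.
rewrite negb_or => /andP[hN hE] h2.
have Nfin : N = (fine N)%:E.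
  rewrite fineK// ge0_fin_numE// ltey; apply: contraNN hN => /eqP ->.
  by rewrite mulry gtr0_sg ?invr_gt0// mul1e.
have Iw : \int[mu]_(x in Q) (w x)%:E < +oo.
  rewrite ltey; apply/eqP => Iy; move: h1.
  by rewrite Iy mulry gtr0_sg ?invr_gt0// mul1e Nfin -!EFinM leye_eq.
have iw : mu.-integrable Q (EFin \o w) by exact: integrable_ge0_lty.
have iL := integrable_lnw Iw hE.
have iE := integrable_exp_ln iw.
have Q0 : (0 < fine (mu Q))%R by rewrite Qv.
have gm : (expR (mean mu Q (fun x => ln (w x))) <= mean mu Q w)%R.
  apply: le_trans (exp_mean_le mQ Q0 iL iE) _.
  by rewrite /mean /Rintegral integral_exp_ln.
have mN : (mean mu Q w <= K * (fine N / Lam))%R.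
  move: h1; rewrite Nfin -!EFinM /mean Qv /Rintegral /=.
  rewrite -[X in _ * X]fineK; last exact: (integrable_fin_num mQ iw).
  by rewrite -EFinM lee_fin mulrC [(Lam^-1 * _)%R]mulrC.
have Npos : (0 < fine N)%R.
  have : (0 < K * (fine N / Lam))%R.
    by apply: lt_le_trans mN; apply: lt_le_trans gm; exact: expR_gt0.
  by rewrite pmulr_rgt0// pmulr_lgt0// invr_gt0.
split => //.
move: h2; rewrite (expe_mean_ln_inv iL) Nfin -!EFinM lee_fin expRN.
by rewrite ler_pdivrMr ?expR_gt0// ler_pdivrMl// mulrA [(Lam * c)%R]mulrC.
Qed.

End weight_on_set.

(** * Norms of a weight over cubes *)

Lemma measurable_mul_indic d (T : measurableType d) (R : realType) (w : T -> R)
    (S : set T) : measurable_fun setT w -> measurable S ->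
  measurable_fun setT (w \* \1_S)%R.
Proof. by move=> mw mS; apply: measurable_funM => //; exact: measurable_indic. Qed.

HB.lock Definition weight_norm {R : realType} {n : nat} (p w : Rn R n -> R)
  (S : set (Rn R n)) : R := fine (Lpnorm p (w \* \1_S)%R).
HB.lock Definition indic_norm {R : realType} {n : nat} (p : Rn R n -> R)
  (Q : set (Rn R n)) : R := fine (Lpnorm p \1_Q).

Section cube_estimates.
Context {R : realType} {n : nat}.
Hypothesis n_gt0 : (0 < n)%N.
Local Notation mu := (@leb R n).

Implicit Types (Q S : set (Rn R n)) (c : 'I_n -> R) (r : R).

Definition vol (Q : set (Rn R n)) : R := fine (mu Q).
Definition lnmean (w : Rn R n -> R) (Q : set (Rn R n)) : R :=
  mean mu Q (fun x => ln (w x)).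

Lemma LpnormE (p f : Rn R n -> R) : Lpnorm p f = luxemburg mu p f.
Proof. by []. Qed.

Lemma cube_vol Q : cube Q -> exists c r,
  [/\ (0 < r)%R, measurable Q, mu Q = (vol Q)%:E, vol Q = ((2 * r) ^+ n)%R &
      Q `<=` ccube c r].
Proof.
move=> /cube_measure[c [r [r0 mQ eQ sQ]]]; exists c, r.
by rewrite /vol eQ; split.
Qed.

Lemma vol_gt0 Q : cube Q -> (0 < vol Q)%R.
Proof. by move=> /cube_vol[c [r [r0 _ _ -> _]]]; rewrite exprn_gt0// mulr_gt0. Qed.

Lemma cube_mu Q : cube Q -> mu Q = (vol Q)%:E.
Proof. by move=> /cube_vol[c [r [_ _ ->]]]. Qed.

Lemma cube_measurable Q : cube Q -> measurable Q.
Proof. by move=> /cube_vol[c [r [_ mQ _ _ _]]]. Qed.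

Lemma vol_ccube (c : 'I_n -> R) (r : R) : (0 < r)%R -> vol (ccube c r) = ((2 * r) ^+ n)%R.
Proof.
move=> r0; rewrite /vol.
have [mB eB] := @borel_lebesgue_box R n
  (fun i => [set` `[c i - r, c i + r]%R]) (fun i => measurable_itv _).
have [mB' eB'] := leb_borel mB.
have -> : mu (ccube c r) = \prod_(i < n) lebesgue_measure [set` `[c i - r, c i + r]%R].
  by rewrite -eB; exact: eB'.
rewrite (eq_bigr (fun=> (2 * r)%:E)).
  by rewrite -(big_morph EFin EFinM erefl) prodr_const card_ord.
move=> i _; rewrite lebesgue_measure_itv /= lte_fin.
have -> : (c i - r < c i + r)%R by lra.
by rewrite -EFinD; congr EFin; ring.
Qed.

Lemma average_mean Q f : cube Q -> average Q f = ((vol Q)^-1)%:E * \int[mu]_(x in Q) (f x)%:E.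
Proof.
move=> cQ; rewrite /average (cube_mu cQ) inver gt_eqF//; exact: vol_gt0.
Qed.

Variables (pmin pmax pinf C0 Cinf Cp : R).
Hypothesis CpP : @average_norm_constant R n pmin pmax pinf C0 Cinf Cp.
Variable p : Rn R n -> R.
Hypothesis hp : LH_exponent pmin pmax pinf C0 Cinf p.

Lemma LH_measurable : measurable_fun setT p.
Proof. by have [_ [mp _ _ _] _ _] := hp. Qed.

Lemma LH_range x : (1 <= p x <= pmax)%R.
Proof.
have [[_ ep] _ _ _] := hp; have := ep x; rewrite /= lee_fin => ->.
by have /andP[] := LH_bounds n_gt0 hp x.
Qed.

Lemma LH_pmax_ge1 : (1 <= pmax)%R.
Proof. by have /andP[] := LH_range [the n.-tuple R of nseq n 0%R]; apply: le_trans. Qed.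

Lemma indic_norm_fin Q : cube Q -> (0 < indic_norm p Q)%R /\ Lpnorm p \1_Q = (indic_norm p Q)%:E.
Proof.
move=> cQ.
have [L L0 eL] := luxemburg_indic_bounds LH_measurable LH_range
  (cube_measurable cQ) (vol_gt0 cQ) (cube_mu cQ).
by rewrite indic_norm.unlock LpnormE eL.
Qed.

(** The average-norm inequality on Q', for the indicator function of Q. *)
Lemma indic_norm_ratio Q Q' : cube Q -> cube Q' -> Q `<=` Q' ->
  (indic_norm p Q' * vol Q <= Cp * vol Q' * indic_norm p Q)%R.
Proof.
move=> cQ cQ' QQ'.
have mI : measurable_fun setT (\1_Q : Rn R n -> R).
  by apply: measurable_indic; exact: cube_measurable.
have [_ /(_ p hp (\1_Q) Q' mI cQ')] := CpP.
have -> : (\1_Q \* \1_Q' : Rn R n -> R)%R = \1_Q.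
  apply/funext => x /=; rewrite !indicE; case: (boolP (x \in Q)) => xQ; last by rewrite mul0r.
  by rewrite mem_set ?mul1r//; apply: QQ'; exact/set_mem.
have [L0 eL] := indic_norm_fin cQ; have [L0' eL'] := indic_norm_fin cQ'.
rewrite eL eL' inver gt_eqF// -EFinM (average_mean _ cQ').
rewrite (eq_integral (fun x => (\1_Q x)%:E)); last first.
  by move=> x _; rewrite ger0_norm// indicE.
rewrite (integral_indic mu (cube_measurable cQ') (cube_measurable cQ)).
rewrite (_ : Q `&` Q' = Q); last exact/setIidl.
rewrite (cube_mu cQ) -!EFinM lee_fin.
have v0 := vol_gt0 cQ'.
rewrite ler_pdivrMl// => h.
rewrite mulrC -ler_pdivlMr//.
by apply: (le_trans h); rewrite le_eqVlt; apply/orP; left; apply/eqP; ring.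
Qed.

Lemma Cp_gt0 : (0 < Cp)%R. Proof. by have [] := CpP. Qed.

Variable w : Rn R n -> R.
Hypothesis hw : Ap_infty p w.
Local Notation wA := (fine (Ap_infty_const p w)).

(** The chain behind everything else: up to the factors Cp and wA, the quotient of
    the norms of w 1_Q and 1_Q lies between the arithmetic and the geometric mean of
    w over Q. *)
Lemma Ap_cube Q : cube Q ->
  [/\ Lpnorm p (w \* \1_Q)%R = (weight_norm p w Q)%:E, (0 < weight_norm p w Q)%R,
      mu.-integrable Q (EFin \o w) /\ mu.-integrable Q (EFin \o (fun x => ln (w x))),
      (expR (lnmean w Q) <= mean mu Q w)%R /\
      (mean mu Q w <= Cp * (weight_norm p w Q / indic_norm p Q))%R &
      (weight_norm p w Q <= wA * indic_norm p Q * expR (lnmean w Q))%R].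
Proof.
move=> cQ; have [[mw w0 wpos] woo] := hw.
have [L0 eL] := indic_norm_fin cQ.
have N0 : 0 <= Lpnorm p (w \* \1_Q)%R by exact: luxemburg_ge0.
have eI : (Lpnorm p \1_Q)^-1 = ((indic_norm p Q)^-1)%:E.
  by rewrite eL inver gt_eqF.
rewrite weight_norm.unlock.
apply: (weight_on_set_bounds (cube_measurable cQ) (vol_gt0 cQ) (cube_mu cQ)
  mw w0 wpos L0 Cp_gt0 N0).
  have [_ /(_ p hp w Q mw cQ)] := CpP.
  have -> : (fun x => `|w x|%R) = w by apply/funext => x; rewrite ger0_norm.
  by rewrite (average_mean _ cQ) eI.
have h : mul_infty ((Lpnorm p \1_Q)^-1 * Lpnorm p (w \* \1_Q)%R)
    (exp_average_log_inv w Q) <= Ap_infty_const p w.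
  by apply: ereal_sup_ubound; exists Q.
have Afin : Ap_infty_const p w \is a fin_num.
  rewrite ge0_fin_numE//; apply: le_trans h.
  rewrite /mul_infty; case: ifP => // _; apply: mule_ge0; last exact: expeR_ge0.
  by rewrite eI; apply: mule_ge0 => //; rewrite lee_fin invr_ge0 ltW.
move: h; rewrite -(fineK Afin) eI /exp_average_log_inv (average_mean _ cQ).
by [].
Qed.

End cube_estimates.

(** * Growth of the norms under dilation of the cube *)

Lemma ln2_le1 (R : realType) : (ln 2 <= 1 :> R)%R.
Proof.
rewrite -[leRHS]expRK ler_ln ?posrE ?expR_gt0//.
by apply: le_trans (expR_ge1Dx _); rewrite -natr1.
Qed.

Section norm_growth.
Variable R : realType.
Local Open Scope ring_scope.

(** Here N / L and N' / L' are comparable to exp g and exp g', up to the factors A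
    and C; the hypothesis on L and L' bounds L' / L by a ratio of volumes. *)
Lemma ln_norm_growth (N N' L L' A C g g' b r : R) (n k : nat) :
  0 < N -> 0 < N' -> 0 < L -> 0 < L' -> 0 < A -> 0 < C -> 0 < r ->
  N' <= A * L' * expR g' -> expR g <= C * (N / L) ->
  L' * (2 * r) ^+ n <= C * (2 * (2 ^+ k * r)) ^+ n * L ->
  `|g - g'| <= (2 ^+ n + 1) * b * k.+1%:R -> 2 <= b -> ln (C * A) <= b - 2 ->
  ln N' <= ln N + (2 ^+ n + n%:R + 3 + `|ln C|) * b * k.+1%:R.
Proof.
move=> N0 N0' L0 L0' A0 C0 r0 hN' hN hL hg b2 hb.
have k1 : 1 <= k.+1%:R :> R by rewrite ler1n.
have e1 : ln N' <= ln A + ln L' + g'.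
  rewrite -[X in _ + X]expRK -!lnM ?posrE ?expR_gt0 ?mulr_gt0//.
  by rewrite ler_ln ?posrE ?mulr_gt0 ?expR_gt0.
have e2 : g + ln L <= ln C + ln N.
  rewrite -[X in X + _ <= _]expRK -!lnM ?posrE ?expR_gt0//.
  rewrite ler_ln ?posrE ?mulr_gt0 ?expR_gt0//.
  by rewrite -ler_pdivlMr// -mulrA.
have e3 : ln L' <= ln C + n%:R * k%:R + ln L.
  have v0 : 0 < (2 * r) ^+ n by rewrite exprn_gt0// mulr_gt0.
  have v0' : 0 < (2 * (2 ^+ k * r)) ^+ n by rewrite exprn_gt0// !mulr_gt0// exprn_gt0.
  have e4 : ln L' + ln ((2 * r) ^+ n) <= ln C + ln ((2 * (2 ^+ k * r)) ^+ n) + ln L.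
    by rewrite -!lnM ?posrE ?mulr_gt0// ler_ln ?posrE ?mulr_gt0.
  have e5 : ln ((2 * (2 ^+ k * r)) ^+ n) = n%:R * (k%:R * ln 2) + ln ((2 * r) ^+ n).
    rewrite (_ : 2 * (2 ^+ k * r) = 2 ^+ k * (2 * r)); last by ring.
    rewrite [X in ln X = _]exprMn [LHS]lnM ?posrE ?exprn_gt0 ?mulr_gt0//.
    by rewrite [ln ((2 ^+ k) ^+ n)]lnXn ?exprn_gt0// [ln (2 ^+ k)]lnXn// !mulr_natl.
  have e6 : n%:R * (k%:R * ln 2) <= n%:R * k%:R :> R.
    by rewrite ler_wpM2l// ler_piMr// ln2_le1.
  by lra.
have e7 : ln C + ln A <= b by rewrite -lnM ?posrE//; lra.
have hgn : g' <= g + (2 ^+ n + 1) * b * k.+1%:R.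
  by move: hg; rewrite ler_norml => /andP[]; lra.
have kK : k%:R <= k.+1%:R :> R by rewrite ler_nat.
set K : R := k.+1%:R in k1 hgn kK *.
have f1 : n%:R * k%:R <= n%:R * (b * K).
  by apply: ler_wpM2l => //; apply: (le_trans kK); nra.
have f2 : 2 * ln C <= `|ln C| * (b * K).
  have bK : 2 <= b * K by nra.
  have := ler_norm (ln C); have : 0 <= `|ln C| by []. nra.
have f3 : b <= b * K by nra.
rewrite -mulrA; rewrite -mulrA in hgn.
set B := b * K in hgn f1 f2 f3 *.
have f4 : 0 <= `|ln C| * B by rewrite mulr_ge0//; lra.
lra.
Qed.

End norm_growth.

Section oscillation_of_weights.
Context {R : realType} {n : nat}.
Hypothesis n_gt0 : (0 < n)%N.
Local Notation mu := (@leb R n).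
Implicit Types (Q S : set (Rn R n)) (c : 'I_n -> R) (r : R).
Variables (pmin pmax pinf C0 Cinf Cp : R).
Hypothesis CpP : @average_norm_constant R n pmin pmax pinf C0 Cinf Cp.
Variable p : Rn R n -> R.
Hypothesis hp : LH_exponent pmin pmax pinf C0 Cinf p.
Variable w : Rn R n -> R.
Hypothesis hw : Ap_infty p w.
Local Notation wA := (fine (Ap_infty_const p w)).
Local Open Scope ring_scope.

(** The geometric mean does not exceed the arithmetic mean. *)
Lemma Ap_const_ge1 : 1 <= Cp * wA.
Proof.
have cQ := @cube_ccube R n (fun=> 0) 1 ltr01.
have [_ N0 _ [h1 h2] h3] := Ap_cube n_gt0 CpP hp hw cQ.
have [L0 _] := indic_norm_fin n_gt0 hp cQ; have C0' := Cp_gt0 CpP.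
have E0 := expR_gt0 (lnmean w (ccube (fun=> 0) 1)).
set g := expR _ in h1 h3 E0; set N := weight_norm _ _ _ in N0 h2 h3.
set L := indic_norm _ _ in h2 h3 L0.
have h4 : g * L <= Cp * N.
  by rewrite -ler_pdivlMr// -mulrA; apply: le_trans h2.
have h5 : Cp * N <= Cp * (wA * L * g) by rewrite ler_pM2l.
have gL : 0 < g * L by rewrite mulr_gt0.
rewrite -(ler_pM2r gL) mul1r; apply: (le_trans h4); apply: (le_trans h5).
by rewrite le_eqVlt; apply/orP; left; apply/eqP; ring.
Qed.

Lemma Ap_const_gt0 : 0 < wA.
Proof.
have := Ap_const_ge1; have := Cp_gt0 CpP => c0 h.
by rewrite -(pmulr_rgt0 _ c0); apply: lt_le_trans h.
Qed.

(** The bound of [mean_abs_le] for ln w: the arithmetic mean of w over a cube is at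
    most Cp * wA times the geometric mean. The losses below are exponentials of
    multiples of this number, hence powers of wA. *)
Definition log_Ap : R := 2 + ln (Cp * wA).

Lemma log_Ap_ge2 : 2 <= log_Ap.
Proof. by rewrite lerDl ln_ge0// Ap_const_ge1. Qed.

Lemma ln_mean_osc Q : cube Q -> exists a,
  mean mu Q (fun x => `|ln (w x) - a|) <= log_Ap.
Proof.
move=> cQ; have [[mw w0 wpos] woo] := hw.
have [_ N0 [iw iL] [h1 h2] h3] := Ap_cube n_gt0 CpP hp hw cQ.
have [L0 _] := indic_norm_fin n_gt0 hp cQ; have C0' := Cp_gt0 CpP.
have mQ := cube_measurable cQ; have v0 := vol_gt0 cQ.
have m0 : 0 < mean mu Q w by apply: lt_le_trans h1; exact: expR_gt0.
have eE : mean mu Q (fun x => expR (ln (w x))) = mean mu Q w.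
  by rewrite /mean /Rintegral (integral_exp_ln mQ mw w0 wpos).
have iE := integrable_exp_ln mQ mw w0 wpos iw.
exists (ln (mean mu Q w)).
apply: (le_trans (mean_abs_le mQ v0 iL iE m0 eE)).
rewrite /log_Ap lerD2l opprB lerBlDr -/(lnmean w Q).
have A1 := Ap_const_ge1.
rewrite -[lnmean w Q]expRK -lnM ?posrE ?expR_gt0//; last by apply: lt_le_trans A1.
rewrite ler_ln ?posrE//; last first.
  by rewrite mulr_gt0 ?expR_gt0//; apply: lt_le_trans A1.
apply: (le_trans h2); rewrite -mulrA ler_pM2l// ler_pdivrMr//.
by apply: (le_trans h3); rewrite le_eqVlt; apply/orP; left; apply/eqP; ring.
Qed.

(** Both means are compared with a constant close to ln w on average over the larger
    cube. *)
Lemma lnmean_nested Q Q' (k : R) : cube Q -> cube Q' -> Q `<=` Q' ->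
  vol Q' <= k * vol Q -> `|lnmean w Q - lnmean w Q'| <= (k + 1) * log_Ap.
Proof.
move=> cQ cQ' QQ' hv; have [a ha] := ln_mean_osc cQ'.
have [_ _ [_ iL] _ _] := Ap_cube n_gt0 CpP hp hw cQ'.
have mQ := cube_measurable cQ; have v0 := vol_gt0 cQ.
have mQ' := cube_measurable cQ'; have v0' := vol_gt0 cQ'.
have h1 := mean_subset mQ' v0' iL a mQ QQ' v0.
have h2 := mean_subset mQ' v0' iL a mQ' (fun=> id) v0'.
rewrite -/(vol Q) -/(vol Q') in h1; rewrite -/(vol Q') divff ?gt_eqF// mul1r in h2.
have b2 := log_Ap_ge2.
have h3 : vol Q' / vol Q * mean mu Q' (fun x => `|ln (w x) - a|) <= k * log_Ap.
  apply: ler_pM => //.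
  - by rewrite divr_ge0 ?(ltW v0) ?(ltW v0').
  - by apply: le_trans h2; exact: normr_ge0.
  - by rewrite ler_pdivrMr.
have -> : lnmean w Q - lnmean w Q' = (lnmean w Q - a) - (lnmean w Q' - a) by ring.
apply: (le_trans (ler_normB _ _)).
rewrite mulrDl mul1r; apply: lerD.
  exact: le_trans h1 h3.
exact: le_trans h2 ha.
Qed.

Lemma ccube_subset c r r' : r <= r' -> ccube c r `<=` (ccube c r' : set (Rn R n)).
Proof.
move=> rr x cx i; have := cx i; rewrite !itv_boundlr !bnd_simp => /andP[h1 h2].
by apply/andP; split; lra.
Qed.

Lemma lnmean_dilate Q c r (k : nat) : cube Q -> 0 < r -> Q `<=` ccube c r ->
  vol Q = (2 * r) ^+ n ->
  `|lnmean w Q - lnmean w (ccube c (2 ^+ k * r))| <= (2 ^+ n + 1) * log_Ap * k.+1%:R.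
Proof.
move=> cQ r0 sQ vQ; have b2 := log_Ap_ge2.
have n1 : 1 <= 2 ^+ n :> R by rewrite exprn_ege1// ler1n.
elim: k => [|k IH].
  rewrite expr0 mul1r mulr1; apply: lnmean_nested => //; first exact: cube_ccube.
  by rewrite vol_ccube// -vQ; have := vol_gt0 cQ; nra.
have rk : 0 < 2 ^+ k * r by rewrite mulr_gt0// exprn_gt0.
have rk1 : 0 < 2 ^+ k.+1 * r by rewrite mulr_gt0// exprn_gt0.
have h : `|lnmean w (ccube c (2 ^+ k * r)) - lnmean w (ccube c (2 ^+ k.+1 * r))|
    <= (2 ^+ n + 1) * log_Ap.
  apply: lnmean_nested; [exact: cube_ccube|exact: cube_ccube| |].
    by apply: ccube_subset; rewrite exprS; lra.
  rewrite !vol_ccube// (_ : 2 * (2 ^+ k.+1 * r) = 2 * (2 * (2 ^+ k * r))).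
    by rewrite [leLHS]exprMn.
  by rewrite exprS; ring.
have -> : lnmean w Q - lnmean w (ccube c (2 ^+ k.+1 * r)) =
  (lnmean w Q - lnmean w (ccube c (2 ^+ k * r))) +
  (lnmean w (ccube c (2 ^+ k * r)) - lnmean w (ccube c (2 ^+ k.+1 * r))) by ring.
apply: (le_trans (ler_normD _ _)).
rewrite -[k.+2%:R]natr1 mulrDr mulr1; exact: lerD.
Qed.

(** The rate at which ln ||w 1_Q|| may grow, in units of log_Ap, when the edge of
    Q is doubled. *)
Definition dilate_rate : R := 2 ^+ n + n%:R + 3 + `|ln Cp|.

Lemma dilate_rate_ge1 : 1 <= dilate_rate.
Proof.
have : 0 <= 2 ^+ n :> R by rewrite exprn_ge0.
have : 0 <= n%:R :> R by []. have : 0 <= `|ln Cp| by []. rewrite /dilate_rate; lra.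
Qed.

Lemma ln_weight_norm_dilate Q c r (k : nat) : cube Q -> 0 < r -> Q `<=` ccube c r ->
  vol Q = (2 * r) ^+ n ->
  ln (weight_norm p w (ccube c (2 ^+ k * r))) <=
    ln (weight_norm p w Q) + dilate_rate * log_Ap * k.+1%:R.
Proof.
move=> cQ r0 sQ vQ.
have rk : 0 < 2 ^+ k * r by rewrite mulr_gt0// exprn_gt0.
have rrk : r <= 2 ^+ k * r by rewrite ler_peMl ?(ltW r0)// exprn_ege1// ler1n.
have hg := lnmean_dilate k cQ r0 sQ vQ.
have vQ' := vol_ccube c rk; have cQ' := @cube_ccube R n c _ rk.
have QQ' := subset_trans sQ (@ccube_subset c _ _ rrk).
have hL := indic_norm_ratio n_gt0 CpP hp cQ cQ' QQ'.
have [_ N0 _ [g1 g2] _] := Ap_cube n_gt0 CpP hp hw cQ.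
have [_ N0' _ _ g3'] := Ap_cube n_gt0 CpP hp hw cQ'.
have [L0 _] := indic_norm_fin n_gt0 hp cQ; have [L0' _] := indic_norm_fin n_gt0 hp cQ'.
rewrite vQ vQ' in hL.
apply: (@ln_norm_growth R _ _ _ _ _ _ _ _ _ r n k N0 N0' L0 L0' Ap_const_gt0
  (Cp_gt0 CpP) r0 g3' (le_trans g1 g2) hL hg log_Ap_ge2).
by rewrite /log_Ap addrC addKr.
Qed.

Lemma weight_norm_subset E Q : measurable E -> cube Q -> E `<=` Q ->
  Lpnorm p (w \* \1_E)%R = (weight_norm p w E)%:E /\ 0 <= weight_norm p w E <= weight_norm p w Q.
Proof.
move=> mE cQ EQ; have [[mw w0 wpos] woo] := hw.
have [eN _ _ _ _] := Ap_cube n_gt0 CpP hp hw cQ.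
have h0 : (0 <= Lpnorm p (w \* \1_E)%R)%E by exact: luxemburg_ge0.
have hle : (Lpnorm p (w \* \1_E)%R <= Lpnorm p (w \* \1_Q)%R)%E.
  exact: (luxemburg_subset mu (LH_measurable hp) (LH_range n_gt0 hp) mE
    (cube_measurable cQ) mw w0 EQ).
move: hle h0; rewrite eN weight_norm.unlock.
by case: (Lpnorm p _) => [N||]//=; rewrite !lee_fin => -> ->.
Qed.

End oscillation_of_weights.

(** * The weight w on large subsets of a cube *)

Lemma mul_infty_EFin (R : realType) (x y : R) : mul_infty x%:E y%:E = (x * y)%:E.
Proof. by []. Qed.

Lemma integral_mul_indic d (T : measurableType d) (R : realType)
    (mu : {measure set T -> \bar R}) (w : T -> R) (E Q : set T) :
  (forall x, 0 <= w x)%R -> E `<=` Q ->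
  \int[mu]_(x in Q) `|(w \* \1_E)%R x|%:E = \int[mu]_(x in E) (w x)%:E.
Proof.
move=> w0 EQ; have EQ' : Q `&` E = E by rewrite setIC; apply/setIidl.
rewrite -{2}EQ' integral_mkcondr; apply: eq_integral => x xQ.
rewrite patchE /= indicE; case: ifPn => xE.
  by rewrite mulr1 ger0_norm.
by rewrite mulr0 normr0.
Qed.

Lemma mass_norm_compare (R : realType) (v L m C A N NE eta : R) (I : \bar R) :
  (0 < v)%R -> (0 < L)%R -> (0 < m)%R -> (0 < C)%R -> (0 < A)%R -> (0 <= N)%R ->
  (0 <= NE)%R ->
  0 <= I -> (eta * (m * v))%:E <= I ->
  (v^-1)%:E * I <= C%:E * ((L^-1)%:E * NE%:E) ->
  (N <= A * L * m)%R -> (eta * N <= C * A * NE)%R.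
Proof.
move=> v0 L0 m0 C0 A0 N0 NE0; case: I => [I||]//; last first.
  by move=> _ _; rewrite mulry gtr0_sg ?invr_gt0// mul1e -!EFinM leye_eq.
rewrite -!EFinM !lee_fin => I0 k2 k1 k4.
have CAN : (0 <= C * A * NE)%R by rewrite !mulr_ge0// ltW.
have [eta0|eta0] := leP eta 0%R.
  by apply: le_trans CAN; rewrite mulr_le0_ge0.
have k3 : (eta * m <= C * (L^-1 * NE))%R.
  rewrite -(ler_pM2r v0) -mulrA; apply: (le_trans k2).
  by rewrite -ler_pdivrMr// mulrC.
apply: (@le_trans _ _ (eta * (A * L * m)))%R; first by rewrite ler_pM2l.
rewrite mulrCA; apply: (@le_trans _ _ (A * L * (C * (L^-1 * NE))))%R.
  by rewrite ler_pM2l// mulr_gt0.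
by rewrite le_eqVlt; apply/orP; left; apply/eqP; field; rewrite gt_eqF.
Qed.

Section reverse_hoelder_step.
Context {R : realType} {n : nat}.
Hypothesis n_gt0 : (0 < n)%N.
Local Notation mu := (@leb R n).
Implicit Types (Q S : set (Rn R n)).
Variable tau : R.
Hypothesis tauP : @reverse_holder_constant R n tau.
Variables (pmin pmax pinf C0 Cinf Cp : R).
Hypothesis CpP : @average_norm_constant R n pmin pmax pinf C0 Cinf Cp.
Variable p : Rn R n -> R.
Hypothesis hp : LH_exponent pmin pmax pinf C0 Cinf p.
Variable w : Rn R n -> R.
Hypothesis hw : Ap_infty p w.
Local Notation wA := (fine (Ap_infty_const p w)).
Local Open Scope ring_scope.

Lemma A_infty_quotient (f : Rn R n -> R) Q : cube Q ->
  mu.-integrable Q (EFin \o f) -> mu.-integrable Q (EFin \o (fun x => ln (f x))) ->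
  mul_infty (average Q f) (exp_average_log_inv f Q) =
  (mean mu Q f * expR (- lnmean f Q))%:E.
Proof.
move=> cQ fi iL; rewrite /exp_average_log_inv !(average_mean _ cQ).
rewrite (expe_mean_ln_inv (cube_measurable cQ) (cube_mu cQ) iL).
rewrite -(fineK (integrable_fin_num (cube_measurable cQ) fi)).
by rewrite -EFinM mul_infty_EFin [X in X * _]mulrC.
Qed.

(** By [Ap_cube] the arithmetic mean of w is at most Cp * wA times the geometric
    mean; this is why delta involves tau * Cp * wA. *)
Lemma weight_A_infty : A_infty w /\ 0 < fine (A_infty_const w) <= Cp * wA.
Proof.
have hub : (A_infty_const w <= (Cp * wA)%:E)%E.
  apply: ge_ereal_sup => _ [Q cQ <-].
  have [_ N0 [iw iL] [h1 h2] h3] := Ap_cube n_gt0 CpP hp hw cQ.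
  have [L0 _] := indic_norm_fin n_gt0 hp cQ; have C0' := Cp_gt0 CpP.
  rewrite (A_infty_quotient cQ iw iL) lee_fin expRN ler_pdivrMr ?expR_gt0//.
  apply: (le_trans h2); rewrite -mulrA ler_pM2l// ler_pdivrMr//.
  by apply: (le_trans h3); rewrite mulrAC.
have hlb : (1%:E <= A_infty_const w)%E.
  have cQ := @cube_ccube R n (fun=> 0) 1 ltr01.
  have [_ N0 [iw iL] [h1 h2] h3] := Ap_cube n_gt0 CpP hp hw cQ.
  apply: (@le_trans _ _ (mul_infty (average (ccube (fun=> 0) 1) w)
    (exp_average_log_inv w (ccube (fun=> 0) 1)))).
    by rewrite (A_infty_quotient cQ iw iL) lee_fin expRN ler_pdivlMr ?expR_gt0// mul1r.
  by apply: ereal_sup_ubound; exists (ccube (fun=> 0) 1).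
have [hw1 _] := hw.
have fin : A_infty_const w \is a fin_num.
  rewrite ge0_fin_numE; first exact: le_lt_trans hub (ltry _).
  by apply: le_trans hlb; rewrite lee_fin.
move: hub hlb; rewrite -(fineK fin) !lee_fin => hub hlb.
split; first by split => //; rewrite -(fineK fin) ltry.
by rewrite hub andbT; apply: lt_le_trans hlb.
Qed.

Local Notation delta := (1 + (tau * Cp * wA)^-1).

(** By the reverse Hoelder inequality for w, the subset E carries a proportion
    1 - 2 alpha ^ (1 - 1/delta) of the integral of w over Q. That integral is at least
    |Q| times the geometric mean of w, while the average-norm inequality for w 1_E
    bounds the integral over E by the norm of w 1_E. *)
Lemma weight_norm_large_subset Q E (alpha : R) : cube Q -> measurable E -> E `<=` Q ->
  0 < alpha -> ((1 - alpha)%:E * mu Q < mu E)%E ->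
  (1 - 2 * alpha `^ (1 - delta^-1)) * weight_norm p w Q <= Cp * wA * weight_norm p w E.
Proof.
move=> cQ mE EQ a0 hE; have [[mw w0 wpos] woo] := hw.
have [tau0 rh] := tauP.
have [hA /andP[A0 A1]] := weight_A_infty.
have C0' := Cp_gt0 CpP; have wA0 := Ap_const_gt0 n_gt0 CpP hp hw.
have tcw : 0 < tau * Cp * wA by rewrite !mulr_gt0.
have d1 : 1 < delta by rewrite ltrDl invr_gt0.
have rng : 1 <= delta <= 1 + (tau * fine (A_infty_const w))^-1.
  apply/andP; split; first exact: ltW.
  have inv_le (t a b : R) : 0 < t -> 0 < a -> a <= b -> 1 + (t * b)^-1 <= 1 + (t * a)^-1.
    move=> t0 a0' ab; rewrite lerD2l lef_pV2 ?posrE ?mulr_gt0//; last exact: lt_le_trans ab.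
    by rewrite ler_pM2l.
  by rewrite -mulrA; apply: inv_le.
have := rh w hA delta rng Q cQ.
have [_ N0 [iw iL] [h1 h2] h3] := Ap_cube n_gt0 CpP hp hw cQ.
have [L0 eL] := indic_norm_fin n_gt0 hp cQ.
have mQ := cube_measurable cQ; have v0 := vol_gt0 cQ; have Qv := cube_mu cQ.
have m0 : 0 < mean mu Q w by apply: lt_le_trans h1; exact: expR_gt0.
have Iw : (\int[mu]_(x in Q) (w x)%:E = (mean mu Q w * vol Q)%:E)%E.
  rewrite /mean -/(vol Q) divfK ?gt_eqF// /Rintegral fineK//.
  exact: (integrable_fin_num mQ iw).
rewrite !(average_mean _ cQ) Iw -!EFinM.
have -> : 2 * ((vol Q)^-1 * (mean mu Q w * vol Q)) = 2 * mean mu Q w.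
  by field; rewrite gt_eqF.
move=> rhQ; rewrite Qv in hE.
have := large_set_mass mQ mE EQ mw w0 v0 m0 d1 a0 Qv Iw rhQ hE.
have mwE : measurable_fun setT (w \* \1_E) by exact: measurable_mul_indic.
have [_ /(_ p hp (w \* \1_E) Q mwE cQ)] := CpP.
have -> : ((w \* \1_E) \* \1_Q : Rn R n -> R) = w \* \1_E.
  apply/funext => x /=; rewrite -mulrA !indicE; congr (_ * _).
  case: (boolP (x \in E)) => xE; last by rewrite mul0r.
  by rewrite mem_set ?mul1r//; apply: EQ; exact/set_mem.
have [eE /andP[NE0 NEQ]] := weight_norm_subset n_gt0 CpP hp hw mE cQ EQ.
have eI : ((Lpnorm p \1_Q)^-1 = ((indic_norm p Q)^-1)%:E)%E by rewrite eL inver (gt_eqF L0).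
rewrite eI eE (average_mean _ cQ).
have -> : (\int[mu]_(x in Q) `|(w \* \1_E)%R x|%:E = \int[mu]_(x in E) (w x)%:E)%E.
  exact: (integral_mul_indic mu w0 EQ).
have IE0 : (0 <= \int[mu]_(x in E) (w x)%:E)%E.
  by apply: integral_ge0 => x _; rewrite lee_fin.
move=> k1 k2.
exact: (mass_norm_compare v0 L0 m0 C0' wA0 (ltW N0) NE0 IE0 k2 k1 (le_trans h3 (ler_wpM2l
  (ltW (mulr_gt0 wA0 L0)) h1))).
Qed.

End reverse_hoelder_step.

(** * From norms to integrals of w ^ p *)

Section modular_versus_norm.
Context {d : measure_display} {T : measurableType d} {R : realType}.
Variables (mu : {measure set T -> \bar R}) (p : T -> R) (P : R).
Hypothesis mp : measurable_fun setT p.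
Hypothesis p1 : forall x, (1 <= p x <= P)%R.
Hypothesis P1 : (1 <= P)%R.
Variable w : T -> R.
Hypotheses (mw : measurable_fun setT w) (w0 : forall x, (0 <= w x)%R).
Implicit Types (S B E : set T).
Local Notation W := (modular mu p w).
Local Notation rho M := (modular mu p (fun x => w x / M)%R).

Let mwM (M : R) : measurable_fun setT (fun x => w x / M)%R.
Proof. exact: measurable_funM. Qed.

Let powE (M : R) x : (0 < M)%R -> (w x `^ p x = (w x / M) `^ p x * M `^ p x)%R.
Proof.
move=> M0; rewrite -powRM ?divr_ge0 ?(ltW M0)//.
by rewrite divfK// gt_eqF.
Qed.

Lemma modular_scale_le S (M k : R) : measurable S -> (0 < M)%R -> (0 <= k)%R ->
  (forall x, S x -> M `^ p x <= k)%R -> W S <= k%:E * rho M S.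
Proof.
move=> mS M0 k0 h; apply: modular_le => // x Sx.
by rewrite (powE x M0) mulrC ler_wpM2r ?powR_ge0// h.
Qed.

Lemma modular_scale_ge S (M k : R) : measurable S -> (0 < M)%R -> (0 < k)%R ->
  (forall x, S x -> k <= M `^ p x)%R -> k%:E * rho M S <= W S.
Proof.
move=> mS M0 k0 h; rewrite -lee_pdivlMl//; apply: modular_le => //.
  by rewrite invr_ge0 ltW.
move=> x Sx; rewrite ler_pdivlMl// (powE x M0) mulrC.
by rewrite ler_wpM2l ?powR_ge0// h.
Qed.

(** These two bounds compare the integral of w ^ p with the modular of w / M when
    M ^ p is controlled only outside an exceptional set B. *)
Lemma modular_split_le S B (M k k' : R) : measurable S -> measurable B ->
  (0 < M)%R -> (0 <= k)%R -> rho M S <= 1 ->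
  (forall x, S x -> ~ B x -> M `^ p x <= k)%R -> W B <= k'%:E ->
  W S <= (k + k')%:E.
Proof.
move=> mS mB M0 k0 hS h hB; rewrite (modular_setID mu mp mS mB mw) addeC EFinD.
have mD : measurable (S `\` B) by exact: measurableD.
apply: leeD.
  apply: (@le_trans _ _ (k%:E * rho M (S `\` B))).
    by apply: modular_scale_le => // x [Sx Bx]; exact: h.
  rewrite -[leRHS]mule1; apply: lee_wpmul2l; first by rewrite lee_fin.
  apply: le_trans hS; exact: (modular_subset mu mp mD mS (mwM M) (@subDsetl _ S B)).
apply: le_trans hB.
apply: (modular_subset mu mp (measurableI _ _ mS mB) mB mw).
exact: subIsetr.
Qed.

Lemma modular_split_ge E B (M k : R) : measurable E -> measurable B ->
  (0 < M)%R -> (0 < k)%R -> 1 <= rho M E -> rho M B <= (2^-1)%:E ->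
  (forall x, E x -> ~ B x -> k <= M `^ p x)%R -> (k / 2)%:E <= W E.
Proof.
move=> mE mB M0 k0 hE hB h.
have mD : measurable (E `\` B) by exact: measurableD.
have hI : rho M (E `&` B) <= (2^-1)%:E.
  apply: le_trans hB.
  apply: (modular_subset mu mp (measurableI _ _ mE mB) mB (mwM M)).
  exact: subIsetr.
have hD : (2^-1)%:E <= rho M (E `\` B).
  move: hE hI; rewrite (modular_setID mu mp mE mB (mwM M)).
  have := modular_ge0 mu p (fun x => w x / M)%R (E `&` B).
  case: (modular _ _ _ (E `&` B)) => [a||]//.
  case: (modular _ _ _ (E `\` B)) => [b||]//; rewrite ?leey//.
  by rewrite -EFinD !lee_fin; lra.
apply: (@le_trans _ _ (W (E `\` B))); last first.
  exact: (modular_subset mu mp mD mE mw (@subDsetl _ E B)).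
apply: (@le_trans _ _ (k%:E * rho M (E `\` B))); last first.
  by apply: modular_scale_ge => // x [Sx Bx]; exact: h.
by rewrite EFinM lee_pmul2l.
Qed.

Lemma modular_le_norm B (beta : R) : measurable B -> (1 <= beta)%R ->
  luxemburg mu p (w \* \1_B)%R <= beta%:E -> W B <= (beta `^ P)%:E.
Proof.
move=> mB b1 hB; have b0 : (0 < beta)%R by apply: lt_le_trans b1.
rewrite -[leRHS]mule1.
apply: (@le_trans _ _ ((beta `^ P)%:E * rho beta B)).
  apply: modular_scale_le => //; first exact: powR_ge0.
  by move=> x _; apply: ler_powR => //; have /andP[] := p1 x.
apply: lee_wpmul2l; first by rewrite lee_fin powR_ge0.
exact: (modular_norm_le1 mp p1 P1 mB mw w0 b0 hB).
Qed.

Lemma modular_half B (beta M : R) : measurable B -> (0 < beta)%R -> (2 * beta <= M)%R ->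
  luxemburg mu p (w \* \1_B)%R <= beta%:E -> rho M B <= (2^-1)%:E.
Proof.
move=> mB b0 bM hB; have M0 : (0 < M)%R by lra.
rewrite -[leRHS]mule1.
apply: (@le_trans _ _ ((2^-1)%:E * rho beta B)); last first.
  apply: lee_wpmul2l; first by rewrite lee_fin.
  exact: (modular_norm_le1 mp p1 P1 mB mw w0 b0 hB).
apply: modular_le => // x _; have /andP[q1 _] := p1 x.
rewrite (_ : w x / M = w x / beta * (beta / M))%R; last by field; rewrite !gt_eqF.
rewrite powRM ?divr_ge0 ?(ltW b0) ?(ltW M0)// mulrC ler_wpM2r ?powR_ge0//.
apply: (@le_trans _ _ (beta / M)%R).
  apply: ge1r_powR => //; rewrite divr_gt0//= ler_pdivrMr//; lra.
by rewrite ler_pdivrMr//; lra.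
Qed.

End modular_versus_norm.

(** * Large norms: cubes about the origin *)

Lemma far_index (R : realType) (X T : R) : (0 < X)%R -> (X <= T)%R ->
  exists j : nat, (1 <= j)%N /\ (j%:R * X <= T)%R /\ (T <= j.+1%:R * X)%R.
Proof.
move=> X0 XT; exists (Num.truncn (T / X)).
have TX : (0 <= T / X)%R by rewrite divr_ge0//; lra.
have /andP[h1 h2] := truncn_itv TX.
split; last by rewrite -ler_pdivlMr// h1 -ler_pdivrMr// ltW.
by rewrite truncn_gt0 ler_pdivlMr// mul1r.
Qed.

Section norm_to_modular.
Context {R : realType} {n : nat}.
Hypothesis n_gt0 : (0 < n)%N.
Local Notation mu := (@leb R n).
Implicit Types (Q S : set (Rn R n)) (c : 'I_n -> R) (r : R).
Variables (pmin pmax pinf C0 Cinf Cp : R).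
Hypothesis CpP : @average_norm_constant R n pmin pmax pinf C0 Cinf Cp.
Variable p : Rn R n -> R.
Hypothesis hp : LH_exponent pmin pmax pinf C0 Cinf p.
Variable w : Rn R n -> R.
Hypothesis hw : Ap_infty p w.
Local Open Scope ring_scope.
Local Notation b := (log_Ap Cp p w).
Local Notation rate := (dilate_rate (n:=n) Cp).
Local Notation N0 := (weight_norm p w cube0).
Local Notation u := (Num.max 0 (ln N0)).
Local Notation W := (modular mu p w).
Local Notation rho M := (modular mu p (fun x => w x / M)).

Definition origin_cube (j : nat) : set (Rn R n) :=
  ccube (fun=> 0) (2 ^+ j * expR 1).

Lemma cube0E : cube0 = ccube (fun=> 0) (expR 1) :> set (Rn R n).
Proof. by congr [set x | _]; apply/funext => x; rewrite sub0r add0r. Qed.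

Lemma cube_cube0 : cube (cube0 : set (Rn R n)).
Proof. by rewrite cube0E; apply: cube_ccube; exact: expR_gt0. Qed.

Lemma cube_origin_cube j : cube (origin_cube j).
Proof. by apply: cube_ccube; rewrite mulr_gt0 ?exprn_gt0 ?expR_gt0. Qed.

Lemma ln_weight_norm_origin j : ln (weight_norm p w (origin_cube j)) <= ln N0 + rate * b * j.+1%:R.
Proof.
apply: (ln_weight_norm_dilate n_gt0 CpP hp hw j cube_cube0 (expR_gt0 1)).
  by rewrite cube0E.
by rewrite cube0E vol_ccube// expR_gt0.
Qed.

(** If ln N_Q = u + T, then T / far_scale is the number of doublings of Q0 after which
    p is close enough to pinf although the norm is still well below N_Q. *)
Definition far_scale : R := 8 * pmax * rate * b.

Lemma far_scale_ge : 16 <= far_scale.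
Proof.
have h1 := LH_pmax_ge1 n_gt0 hp; have h2 := log_Ap_ge2 n_gt0 CpP hp hw.
have h3 := @dilate_rate_ge1 R n Cp; rewrite /far_scale.
move: pmax rate b h1 h2 h3 => a e f h1 h2 h3.
have : 1 <= a * e by nra. nra.
Qed.

(** Take j of order T / far_scale. Each doubling of Q0 multiplies the norm by at most
    exp (rate * b), which gives the two upper bounds; outside the j-th cube the decay
    of p - pinf is of order 1 / j, that is, of order far_scale / T. *)
Lemma far_origin_cube (T : R) : far_scale <= T -> exists j : nat,
  [/\ (1 <= j)%N, ln (weight_norm p w (origin_cube j)) <= u + T / (2 * pmax),
      ln (weight_norm p w (origin_cube (j + j))) <= u + T / (2 * pmax),
      T <= j.+1%:R * far_scale &
      forall x, ~ origin_cube j x -> `|p x - pinf| * T <= 2 * far_scale * Cinf].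
Proof.
move=> hT; have X16 := far_scale_ge.
have X0 : 0 < far_scale by lra.
have [j [j1 [hj1 hj2]]] := far_index X0 hT.
have h1 := LH_pmax_ge1 n_gt0 hp; have h2 := log_Ap_ge2 n_gt0 CpP hp hw.
have h3 := @dilate_rate_ge1 R n Cp.
have lnu : ln N0 <= u by rewrite le_max lexx orbT.
have arith (k : nat) (Nk : R) : (k <= j + j)%N -> ln Nk <= ln N0 + rate * b * k.+1%:R ->
    ln Nk <= u + T / (2 * pmax).
  move=> kj hk; apply: (le_trans hk); apply: lerD => //.
  rewrite ler_pdivlMr; last lra.
  have kR : k.+1%:R <= 2 * j%:R + 1 :> R.
    by rewrite -natr1 lerD2r mulr_natl mulr2n -natrD ler_nat.
  move: hj1 hT X0; rewrite /far_scale => hj1 hT X0.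
  have rb : 0 <= rate * b by rewrite mulr_ge0//; lra.
  have : rate * b * k.+1%:R * (2 * pmax) <= rate * b * (2 * j%:R + 1) * (2 * pmax).
    by rewrite ler_wpM2r//; [lra|rewrite ler_wpM2l].
  have e1 : rate * b * (2 * j%:R + 1) * (2 * pmax) =
     2^-1 * (j%:R * (8 * pmax * rate * b)) + 4^-1 * (8 * pmax * rate * b) by field.
  rewrite e1; lra.
exists j; split => //.
- by apply: (arith j) (ln_weight_norm_origin j); rewrite leq_addr.
- by apply: (arith (j + j)%N) (ln_weight_norm_origin (j + j)).
move=> x nBx; have [i hi] : exists i, 2 ^+ j * expR 1 <= `|tnth x i|.
  apply: contrapT => h; apply: nBx => i; rewrite sub0r add0r itv_boundlr !bnd_simp -ler_norml.
  by rewrite leNgt; apply/negP => hx; apply: h; exists i; exact: ltW.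
have a0 : 0 <= 2 ^+ j * expR 1 :> R by rewrite mulr_ge0 ?exprn_ge0 ?expR_ge0.
have dec := LH_decay hp a0 hi.
have Ci0 : 0 < Cinf by have [_ [_ [_ _ ?] _ _] _ _] := hp.
have lj : j.+1%:R / 2 <= ln (expR 1 + 2 ^+ j * expR 1) :> R.
  apply: (@le_trans _ _ (ln (2 ^+ j * expR 1))).
    rewrite lnM ?posrE ?exprn_gt0 ?expR_gt0// expRK lnXn// -[ln 2 *+ j]mulr_natl.
    have h : j%:R * (1 / 2) <= j%:R * ln 2 :> R by rewrite ler_wpM2l// ln2_ge.
    by rewrite -[j.+1%:R]natr1; lra.
  by rewrite ler_ln ?posrE ?addr_gt0 ?mulr_gt0 ?exprn_gt0 ?expR_gt0// lerDr expR_ge0.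
have jR : 0 < j.+1%:R :> R by rewrite ltr0n.
have lj0 : 0 < ln (expR 1 + 2 ^+ j * expR 1) :> R by apply: lt_le_trans lj; rewrite divr_gt0.
have dec2 : `|p x - pinf| * j.+1%:R <= 2 * Cinf.
  move: dec; rewrite ler_pdivlMr// => dec.
  have : `|p x - pinf| * (j.+1%:R / 2) <= `|p x - pinf| * ln (expR 1 + 2 ^+ j * expR 1).
    by rewrite ler_wpM2l.
  lra.
apply: (@le_trans _ _ (`|p x - pinf| * (j.+1%:R * far_scale))).
  by rewrite ler_wpM2l.
rewrite mulrA; apply: (@le_trans _ _ (2 * Cinf * far_scale)).
  by rewrite ler_wpM2r// ltW.
by rewrite mulrAC.
Qed.

Let mw : measurable_fun setT w. Proof. by have [[? _ _] _] := hw. Qed.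
Let w0 : forall x, 0 <= w x. Proof. by have [[_ ? _] _] := hw. Qed.
Let mp := LH_measurable hp.
Let pr := LH_range n_gt0 hp.
Let P1 := LH_pmax_ge1 n_gt0 hp.

Lemma rho_weight_norm_le1 Q : cube Q -> (rho (weight_norm p w Q) Q <= 1)%E.
Proof.
move=> cQ; have [eN N_gt0 _ _ _] := Ap_cube n_gt0 CpP hp hw cQ.
apply: (modular_norm_le1 mp pr P1 (cube_measurable cQ) mw w0 N_gt0).
by rewrite -eN; exact: lexx.
Qed.

Lemma rho_weight_norm_ge1 Q E (M : R) : cube Q -> measurable E -> E `<=` Q -> 0 < M ->
  M <= weight_norm p w E -> (1 <= rho M E)%E.
Proof.
move=> cQ mE EQ M0 ME; have [eE _] := weight_norm_subset n_gt0 CpP hp hw mE cQ EQ.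
apply: (modular_norm_ge1 mp pr P1 mE mw w0 M0).
by rewrite -[X in (_ <= X)%E]/(Lpnorm p (w \* \1_E)) eE lee_fin.
Qed.

Lemma luxemburg_origin_le j (beta : R) : ln (weight_norm p w (origin_cube j)) <= beta ->
  (luxemburg mu p (w \* \1_(origin_cube j))%R <= (expR beta)%:E)%E.
Proof.
move=> h; have [eN N_gt0 _ _ _] := Ap_cube n_gt0 CpP hp hw (cube_origin_cube j).
rewrite -[X in (X <= _)%E]/(Lpnorm p (w \* \1_(origin_cube j))) eN lee_fin.
by rewrite -[leLHS]lnK ?posrE// ler_expR.
Qed.

End norm_to_modular.

(** * Comparison of the integrals of w ^ p over Q and E *)

Lemma le_ln (R : realType) (x y : R) : (0 < x)%R -> (x <= y)%R -> (ln x <= ln y)%R.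
Proof. by move=> x0 xy; rewrite ler_ln ?posrE//; exact: lt_le_trans xy. Qed.

Section mass_comparison.
Context {R : realType} {n : nat}.
Hypothesis n_gt0 : (0 < n)%N.
Local Notation mu := (@leb R n).
Implicit Types (Q S : set (Rn R n)) (c : 'I_n -> R) (r : R).
Variables (pmin pmax pinf C0 Cinf Cp : R).
Hypothesis CpP : @average_norm_constant R n pmin pmax pinf C0 Cinf Cp.
Variable p : Rn R n -> R.
Hypothesis hp : LH_exponent pmin pmax pinf C0 Cinf p.
Variable w : Rn R n -> R.
Hypothesis hw : Ap_infty p w.
Local Open Scope ring_scope.
Local Notation b := (log_Ap Cp p w).
Local Notation rate := (dilate_rate (n:=n) Cp).
Local Notation N0 := (weight_norm p w cube0).
Local Notation u := (Num.max 0 (ln N0)).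
Local Notation W := (modular mu p w).
Local Notation rho M := (modular mu p (fun x => w x / M)).
Local Notation X := (far_scale (n:=n) pmax Cp p w).

Variable c1 : R.
Hypothesis c1_ge0 : 0 <= c1.
Hypothesis hosc : forall (c : 'I_n -> R) r, 0 < r -> exists k : nat,
  cube0 `<=` ccube c (2 ^+ k * r) /\
  forall x y, ccube c r x -> ccube c r y -> `|p x - p y| * k.+1%:R <= c1.

(** k - 1 counts the doublings that take Q to a cube containing Q0, whose norm is at
    least that of Q0. *)
Lemma small_norm_osc Q : cube Q -> exists2 k : R, 1 <= k &
  - ln (weight_norm p w Q) <= rate * b * k + `|ln N0| /\
  forall x y, Q x -> Q y -> `|p x - p y| * k <= c1.
Proof.
move=> cQ; have [c [r [r0 mQ _ vQ sQ]]] := cube_vol cQ.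
have [k [k0 ko]] := hosc c r0.
exists k.+1%:R; first by rewrite ler1n.
split; last by move=> x y Qx Qy; apply: ko; exact: sQ.
have rk : 0 < 2 ^+ k * r by rewrite mulr_gt0// exprn_gt0.
have h1 := ln_weight_norm_dilate n_gt0 CpP hp hw k cQ r0 sQ vQ.
have [_ /andP[_ h2]] := weight_norm_subset n_gt0 CpP hp hw
  (cube_measurable (cube_cube0 (R:=R) (n:=n)))
  (cube_ccube c rk) k0.
have [_ N0_gt0 _ _ _] := Ap_cube n_gt0 CpP hp hw (cube_cube0 (R:=R) (n:=n)).
have h3 : ln N0 <= ln (weight_norm p w (ccube c (2 ^+ k * r))).
  by exact: (le_ln N0_gt0 h2).
have h4 : - ln N0 <= `|ln N0| by rewrite -normrN ler_norm.
move: h1 h3 h4; lra.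
Qed.

Let mw : measurable_fun setT w. Proof. by have [[? _ _] _] := hw. Qed.
Let w0 : forall x, 0 <= w x. Proof. by have [[_ ? _] _] := hw. Qed.
Let mp := LH_measurable hp.
Let pr := LH_range n_gt0 hp.
Let P1 := LH_pmax_ge1 n_gt0 hp.

Lemma W_le_of_exponent Q (lM a : R) : cube Q -> lM = ln (weight_norm p w Q) ->
  (forall x, Q x -> lM * p x <= a) -> (W Q <= (2 * expR a)%:E)%E.
Proof.
move=> cQ elM h; have [_ N_gt0 _ _ _] := Ap_cube n_gt0 CpP hp hw cQ.
have hN := rho_weight_norm_le1 n_gt0 CpP hp hw cQ.
have eN : weight_norm p w Q = expR lM by rewrite elM (lnK N_gt0).
rewrite eN in hN.
have W0 : (W set0 <= 0%:E)%E by rewrite /modular integral_set0.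
have ha : forall x, Q x -> ~ set0 x -> expR lM `^ p x <= expR a.
  by move=> x Qx _; rewrite -expRM ler_expR; exact: h.
have := modular_split_le mp mw w0 (cube_measurable cQ) measurable0 (expR_gt0 _)
  (expR_ge0 _) hN ha W0.
move=> /le_trans; apply; rewrite lee_fin addr0.
by have := expR_ge0 a; lra.
Qed.

Lemma W_ge_of_exponent E (lM a : R) : measurable E -> (1 <= rho (expR lM) E)%E ->
  (forall x, E x -> a <= lM * p x) -> ((expR a / 2)%:E <= W E)%E.
Proof.
move=> mE hE h.
have W0 : (rho (expR lM) set0 <= (2^-1)%:E)%E.
  by rewrite /modular integral_set0 lee_fin invr_ge0.
have ha : forall x, E x -> ~ set0 x -> expR a <= expR lM `^ p x.
  by move=> x Ex _; rewrite -expRM ler_expR; exact: h.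
exact: (modular_split_ge mp mw w0 mE measurable0 (expR_gt0 lM) (expR_gt0 a) hE W0 ha).
Qed.

(** Outside the j-th cube about the origin N ^ p is comparable to N ^ pinf, and the
    integral over that cube is bounded by a power of its norm. The factor
    exp (u * (pmax - pinf)) and the factor exp (- u * (pinf - pmin)) of the lower bound
    combine to a single power exp (u * (pmax - pmin)), bounded by L_w. *)
Lemma W_le_far Q (T : R) : cube Q -> X <= T -> ln (weight_norm p w Q) = u + T ->
  (W Q <= (2 * expR (pinf * (u + T) + 2 * X * Cinf + u * (pmax - pinf)))%:E)%E.
Proof.
move=> cQ hT eT; have [_ N_gt0 _ _ _] := Ap_cube n_gt0 CpP hp hw cQ.
have [j [_ hj _ _ hout]] := far_origin_cube n_gt0 CpP hp hw hT.
have u0 : 0 <= u by rewrite le_max lexx.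
have /andP[q1 q2] := LH_pinf_bounds n_gt0 hp; have q3 := LH_pmin_ge1 hp.
have X16 := far_scale_ge n_gt0 CpP hp hw.
have Ci0 : 0 < Cinf by have [_ [_ [_ _ ?] _ _] _ _] := hp.
have hN := rho_weight_norm_le1 n_gt0 CpP hp hw cQ.
rewrite -[weight_norm p w Q](lnK N_gt0) eT in hN.
set a2 := pinf * (u + T) + _ + _.
have hout' x : Q x -> ~ origin_cube j x -> expR (u + T) `^ p x <= expR a2.
  move=> _ nB; rewrite -expRM ler_expR /a2.
  have /andP[r1 r2] := LH_bounds n_gt0 hp x.
  have := hout x nB; have : (p x - pinf) * T <= `|p x - pinf| * T.
    by rewrite ler_wpM2r ?ler_norm//; lra.
  have : u * (p x - pinf) <= u * (pmax - pinf) by rewrite ler_wpM2l//; lra.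
  lra.
have beta1 : 1 <= expR (u + T / (2 * pmax)).
  by rewrite -[leLHS]expR0 ler_expR addr_ge0// divr_ge0//; lra.
have mB := cube_measurable (cube_origin_cube (R:=R) (n:=n) j).
have hB := modular_le_norm mp pr P1 mw w0 mB beta1
  (luxemburg_origin_le n_gt0 CpP hp hw hj).
have hB' : (W (origin_cube j) <= (expR a2)%:E)%E.
  apply: (le_trans hB); rewrite lee_fin -expRM ler_expR mulrDl.
  have -> : T / (2 * pmax) * pmax = T / 2 by field; lra.
  rewrite /a2; have : 0 <= X * Cinf by rewrite mulr_ge0//; lra.
  have : T / 2 <= pinf * T by nra.
  lra.
have := modular_split_le mp mw w0 (cube_measurable cQ) mB (expR_gt0 _)
  (expR_ge0 _) hN hout' hB'.
by rewrite (_ : expR a2 + expR a2 = 2 * expR a2)//; ring.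
Qed.

(** The modular of w / M over the j-th cube about the origin is at most 1/2, so at
    least half of the modular over E lies where p is close to pinf. *)
Lemma W_ge_far E (T : R) : measurable E -> X <= T -> (1 <= rho (expR (u + T)) E)%E ->
  ((expR (pinf * (u + T) - 2 * X * Cinf - u * (pinf - pmin)) / 2)%:E <= W E)%E.
Proof.
move=> mE hT hE.
have [j [_ hj _ _ hout]] := far_origin_cube n_gt0 CpP hp hw hT.
have u0 : 0 <= u by rewrite le_max lexx.
have /andP[q1 q2] := LH_pinf_bounds n_gt0 hp; have q3 := LH_pmin_ge1 hp.
have X16 := far_scale_ge n_gt0 CpP hp hw.
set a1 := pinf * (u + T) - _ - _.
have hout' x : E x -> ~ origin_cube j x -> expR a1 <= expR (u + T) `^ p x.
  move=> _ nB; rewrite -expRM ler_expR /a1.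
  have /andP[r1 r2] := LH_bounds n_gt0 hp x.
  have := hout x nB; have : - (`|p x - pinf| * T) <= (p x - pinf) * T.
    by rewrite -mulNr ler_wpM2r//; [lra|rewrite lerNl -normrN ler_norm].
  have : u * (pmin - pinf) <= u * (p x - pinf) by rewrite ler_wpM2l//; lra.
  lra.
have mB := cube_measurable (cube_origin_cube (R:=R) (n:=n) j).
have half : 2 * expR (u + T / (2 * pmax)) <= expR (u + T).
  have -> : expR (u + T) = expR (u + T / (2 * pmax)) * expR (T - T / (2 * pmax)).
    by rewrite -expRD; congr expR; ring.
  rewrite mulrC ler_pM2l ?expR_gt0//.
  apply: le_trans (expR_ge1Dx _).
  have : T / (2 * pmax) <= T / 2.
    rewrite ler_pdivrMr; last lra.
    nra.
  lra.
have hB := modular_half mp pr P1 mw w0 mB (expR_gt0 _) half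
  (luxemburg_origin_le n_gt0 CpP hp hw hj).
exact: (modular_split_ge mp mw w0 mE mB (expR_gt0 _) (expR_gt0 a1) hE hB hout').
Qed.

Definition compare_cst : R :=
  rate * c1 + 8 * pmax * rate * ((pmax - pmin) + 4 * Cinf).

(** With N = ||w 1_Q|| and M = N / D <= ||w 1_E||, the modular of w / N over Q is at
    most 1 and that of w / M over E at least 1. The powers N ^ p and M ^ p are replaced
    by constants in one of four regimes: N <= 1, where the oscillation of p over Q
    matters; M <= 1 < N; M moderately large; M large. In the first regime the
    constants are powers with exponent sup_Q p in both bounds, so that only one factor
    L_w is lost. *)
Lemma W_compare Q E (lD : R) : cube Q -> measurable E -> E `<=` Q -> 0 <= lD ->
  weight_norm p w Q <= expR lD * weight_norm p w E -> exists a1 a2 s,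
  [/\ 0 <= s <= pmax - pmin, (W Q <= (2 * expR a2)%:E)%E,
      ((expR a1 / 2)%:E <= W E)%E &
      a2 - a1 <= pmax * lD + compare_cst * b + s * `|ln N0| ].
Proof.
move=> cQ mE EQ lD0 hN; have [_ N_gt0 _ _ _] := Ap_cube n_gt0 CpP hp hw cQ.
set lN := ln (weight_norm p w Q).
have u0 : 0 <= u by rewrite le_max lexx.
have un : u <= `|ln N0| by rewrite ge_max normr_ge0 ler_norm.
have /andP[q1 q2] := LH_pinf_bounds n_gt0 hp; have q3 := LH_pmin_ge1 hp.
have X16 := far_scale_ge n_gt0 CpP hp hw.
have Ci0 : 0 < Cinf by have [_ [_ [_ _ ?] _ _] _ _] := hp.
have b2 := log_Ap_ge2 n_gt0 CpP hp hw.
have rate1 := @dilate_rate_ge1 R n Cp.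
have n00 : 0 <= `|ln N0| by [].
have hM : (1 <= rho (expR (lN - lD)) E)%E.
  apply: (rho_weight_norm_ge1 n_gt0 CpP hp hw cQ mE EQ (expR_gt0 _)).
  by rewrite expRB /lN (lnK N_gt0) (ler_pdivrMr _ _ (expR_gt0 lD)) mulrC.
have csum : compare_cst * b = rate * b * c1 + (X * (pmax - pmin) + 4 * X * Cinf).
  by rewrite /compare_cst /far_scale; ring.
have c0 : 0 <= rate * b * c1 by rewrite !mulr_ge0//; lra.
have cX : 0 <= X * (pmax - pmin) by rewrite mulr_ge0//; lra.
have cC : 0 <= X * Cinf by rewrite mulr_ge0//; lra.
have [lN0|lN0] := leP lN 0.
  have [k k1 [hk hko]] := small_norm_osc cQ.
  pose s := sup (p @` Q).
  have Qne : exists x, Q x.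
    have [x Qx _] := ex_ae_cube cQ (aeW mu (fun=> I)).
    by exists x.
  have hs : has_sup (p @` Q).
    split; first by have [x Qx] := Qne; exists (p x); exists x.
    by exists pmax => _ [x _ <-]; have /andP[] := LH_bounds n_gt0 hp x.
  have ps x : Q x -> p x <= s by move=> Qx; apply: sup_upper_bound => //; exists x.
  have sle (y : R) : (forall x, Q x -> p x <= y) -> s <= y.
    by move=> h; apply: ge_sup; [case: hs|move=> _ [x Qx <-]; exact: h].
  have s1 : s <= pmax by apply: sle => x _; have /andP[] := LH_bounds n_gt0 hp x.
  have sp x : Q x -> (s - p x) * k <= c1.
    move=> Qx; rewrite -ler_pdivlMr; last lra.
    rewrite lerBlDr; apply: sle => y Qy.
    rewrite -lerBlDr ler_pdivlMr; last lra.
    by apply: le_trans (hko y x Qy Qx); rewrite ler_wpM2r ?ler_norm//; lra.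
  exists (s * lN - pmax * lD), (s * lN + rate * b * c1 + (pmax - pmin) * `|ln N0|), (pmax - pmin).
  split; first by apply/andP; split; lra.
  - apply: (W_le_of_exponent (lM := lN) cQ erefl) => x Qx.
    have /andP[r1 r2] := LH_bounds n_gt0 hp x.
    have h1 : 0 <= s - p x by rewrite subr_ge0 ps.
    have h2 : (s - p x) * (- lN) <= (s - p x) * (rate * b * k + `|ln N0|).
      by rewrite ler_wpM2l.
    have h3 : rate * b * ((s - p x) * k) <= rate * b * c1.
      by rewrite ler_wpM2l ?sp// mulr_ge0//; lra.
    have h4 : (s - p x) * `|ln N0| <= (pmax - pmin) * `|ln N0|.
      by rewrite ler_wpM2r//; lra.
    lra.
  - apply: (W_ge_of_exponent mE hM) => x Ex.
    have /andP[r1 r2] := LH_bounds n_gt0 hp x.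
    have h1 := ps x (EQ x Ex).
    have h2 : lN * s <= lN * p x by rewrite ler_wnM2l.
    have h3 : lD * p x <= lD * pmax by rewrite ler_wpM2l.
    lra.
  - by rewrite csum; lra.
have [ca|ca] := leP (lN - lD) 0.
  exists (pmax * (lN - lD)), (pmax * lN), 0; split.
  - by apply/andP; split; lra.
  - apply: (W_le_of_exponent (lM := lN) cQ erefl) => x Qx.
    have /andP[r1 r2] := LH_bounds n_gt0 hp x.
    by rewrite mulrC ler_wpM2r// ltW.
  - apply: (W_ge_of_exponent mE hM) => x Ex.
    have /andP[r1 r2] := LH_bounds n_gt0 hp x.
    by rewrite mulrC ler_wnM2l.
  - by rewrite csum; lra.
have [cb|cb] := leP (lN - lD) (u + X).
  exists (pmin * (lN - lD)), (pmax * lN), (pmax - pmin); split.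
  - by apply/andP; split; lra.
  - apply: (W_le_of_exponent (lM := lN) cQ erefl) => x Qx.
    have /andP[r1 r2] := LH_bounds n_gt0 hp x.
    by rewrite mulrC ler_wpM2r// ltW.
  - apply: (W_ge_of_exponent mE hM) => x Ex.
    have /andP[r1 r2] := LH_bounds n_gt0 hp x.
    by rewrite mulrC ler_wpM2l// ltW.
  - have h1 : (pmax - pmin) * (lN - lD) <= (pmax - pmin) * (u + X).
      by rewrite ler_wpM2l//; lra.
    have h2 : (pmax - pmin) * u <= (pmax - pmin) * `|ln N0|.
      by rewrite ler_wpM2l//; lra.
    by rewrite csum; lra.
exists (pinf * (u + (lN - lD - u)) - 2 * X * Cinf - u * (pinf - pmin)),
  (pinf * (u + (lN - u)) + 2 * X * Cinf + u * (pmax - pinf)), (pmax - pmin); split.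
- by apply/andP; split; lra.
- by apply: W_le_far => //; [lra|rewrite -/lN; ring].
- have eT : u + (lN - lD - u) = lN - lD by ring.
  have hT : X <= lN - lD - u by lra.
  rewrite -{}eT in hM.
  exact: (W_ge_far mE hT hM).
- have h2 : (pmax - pmin) * u <= (pmax - pmin) * `|ln N0|.
    by rewrite ler_wpM2l//; lra.
  have h3 : pinf * lD <= pmax * lD by rewrite ler_wpM2r.
  by rewrite csum; lra.
Qed.

End mass_comparison.

(** * The integral of w ^ p as a power of the norm *)

Lemma succ_le_exp2 (R : realType) (j : nat) : (2 <= j)%N ->
  (j.+1%:R <= 2 * (2 ^+ j - 1) :> R)%R.
Proof.
elim: j => // j IH; rewrite ltnS leq_eqVlt => /predU1P[<-|j2].
  by rewrite expr2; lra.
have := IH j2; rewrite exprS -[X in (_ -> X <= _)%R]natr1.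
have : (1 <= j.+1%:R :> R)%R by rewrite ler1n.
lra.
Qed.

Lemma fine_le_EFin (R : realType) (x : \bar R) (v : R) :
  0 <= x -> x <= v%:E -> (fine x <= v)%R.
Proof. by case: x. Qed.

Section mean_of_bounded.
Context {d : measure_display} {T : measurableType d} {R : realType}.
Variable mu : {measure set T -> \bar R}.
Local Open Scope ring_scope.

Lemma mean_dist_le (Q B : set T) (f : T -> R) (a e P : R) :
  measurable Q -> 0 < fine (mu Q) -> measurable B -> measurable_fun setT f ->
  (forall x, `|f x - a| <= P) -> (forall x, Q x -> ~ B x -> `|f x - a| <= e) ->
  0 <= e ->
  `|mean mu Q f - a| <= e + P * (fine (mu (Q `&` B)) / fine (mu Q)).
Proof.
move=> mQ Q0 mB mf hP he e0.
have P0 (x : T) : 0 <= P by exact: le_trans (normr_ge0 _) (hP x).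
have Qfin : (mu Q < +oo)%E.
  by move: Q0; case: (mu Q) => [v _||]; rewrite ?ltxx ?ltry.
have mB1 : measurable_fun Q (\1_B : T -> R) by exact: measurable_indic.
have iB : mu.-integrable Q (EFin \o (\1_B : T -> R)).
  apply: (le_integrable mQ _ _ (intble_cst mQ Q0 1)).
    exact/measurable_EFinP.
  move=> x _; rewrite /= lee_fin indicE normr1.
  by case: (x \in B); rewrite ?normr1 ?normr0.
have mfQ : measurable_fun Q f by exact: measurable_funS mf.
have iF : mu.-integrable Q (EFin \o f).
  apply: (le_integrable mQ _ _ (intble_cst mQ Q0 (`|a| + P))).
    exact/measurable_EFinP.
  move=> x _; rewrite /= lee_fin [leRHS]ger0_norm; last by rewrite addr_ge0// (P0 x).
  rewrite (_ : f x = a + (f x - a)); last by ring.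
  by apply: (le_trans (ler_normD _ _)); rewrite lerD2l.
have eB : mean mu Q (\1_B : T -> R) = fine (mu (Q `&` B)) / fine (mu Q).
  by rewrite /mean /Rintegral integral_indic// setIC.
have bound x : Q x -> `|f x - a| <= e + P * \1_B x.
  move=> Qx; rewrite indicE; have [xB|xB] := boolP (x \in B).
    by rewrite mulr1; apply: (le_trans (hP x)); rewrite lerDr.
  rewrite mulr0 addr0; apply: he => //.
  by move=> Bx; move: xB; rewrite mem_set.
have iC k := intble_cst mQ Q0 k.
have up : mean mu Q f <= mean mu Q (fun x => (a + e) + P * \1_B x).
  apply: le_mean => //.
    by apply: (intbleD mQ (iC _)); apply: (intbleZ mQ P iB).
  by move=> x Qx; rewrite -addrA -lerBlDl; apply: le_trans (bound x Qx); exact: ler_norm.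
have lo : mean mu Q (fun x => (a - e) + (- P) * \1_B x) <= mean mu Q f.
  apply: le_mean => //.
    by apply: (intbleD mQ (iC _)); apply: (intbleZ mQ (- P) iB).
  move=> x Qx; rewrite mulNr -addrA -opprD lerBlDl -lerBlDr.
  by apply: le_trans (bound x Qx); rewrite distrC; exact: ler_norm.
move: up lo; rewrite !meanD//; try exact: intbleZ.
rewrite !meanZ// !mean_cst// eB => up lo.
by rewrite ler_distl opprD !addrA up -mulNr lo.
Qed.

End mean_of_bounded.

Section modular_mean_exponent.
Context {R : realType} {n : nat}.
Hypothesis n_gt0 : (0 < n)%N.
Local Notation mu := (@leb R n).
Implicit Types (Q S : set (Rn R n)) (c : 'I_n -> R) (r : R).
Variables (pmin pmax pinf C0 Cinf Cp : R).
Hypothesis CpP : @average_norm_constant R n pmin pmax pinf C0 Cinf Cp.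
Variable p : Rn R n -> R.
Hypothesis hp : LH_exponent pmin pmax pinf C0 Cinf p.
Local Open Scope ring_scope.

Variable c1 : R.
Hypothesis c1_ge0 : 0 <= c1.
Hypothesis hosc : forall (c : 'I_n -> R) r, 0 < r -> exists k : nat,
  cube0 `<=` ccube c (2 ^+ k * r) /\
  forall x y, ccube c r x -> ccube c r y -> `|p x - p y| * k.+1%:R <= c1.

(** The edge of such a cube is at least of order 4 ^ j, against 2 ^ j for the j-th
    cube about the origin. *)
Lemma cube_crossing_ratio Q j x y : cube Q -> (1 <= j)%N -> Q x -> Q y ->
  origin_cube j x -> ~ origin_cube (j + j) y ->
  fine (mu (Q `&` origin_cube j)) / vol Q * j.+1%:R <= 4.
Proof.
move=> cQ j1 Qx Qy Bx nBy.
have cB := cube_origin_cube (R := R) (n := n) j.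
have mQ := cube_measurable cQ; have mB := cube_measurable cB.
have v0 := vol_gt0 cQ.
have jR : 1 <= j%:R :> R by rewrite ler1n.
have le_fine (S : set (Rn R n)) : cube S -> Q `&` origin_cube j `<=` S ->
    fine (mu (Q `&` origin_cube j)) <= vol S.
  move=> cS sub; have : (mu (Q `&` origin_cube j) <= mu S)%E.
    by apply: le_measure => //; rewrite inE; [exact: measurableI|exact: cube_measurable].
  by rewrite (cube_mu cS); apply: fine_le_EFin; exact: measure_ge0.
have hQ := le_fine Q cQ (@subIsetl _ _ _).
have hB := le_fine _ cB (@subIsetr _ _ _).
set q := fine _ in hQ hB *.
have q1 : q / vol Q <= 1 by rewrite ler_pdivrMr// mul1r.
have [j2|j2] := leqP 2 j; last first.
  have -> : j = 1%N by apply/eqP; rewrite eqn_leq j1 -ltnS j2.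
  by move: q1; lra.
have [c [r [r0 _ _ vQ sQ]]] := cube_vol cQ.
have [i hi] : exists i, 2 ^+ (j + j) * expR 1 < `|tnth y i|.
  apply: contrapT => h; apply: nBy => i; rewrite sub0r add0r itv_boundlr !bnd_simp -ler_norml.
  by rewrite leNgt; apply/negP => hx; apply: h; exists i.
have hr : 2 ^+ j * (2 ^+ j - 1) * expR 1 <= 2 * r.
  have := sQ x Qx i; have := sQ y Qy i; rewrite !itv_boundlr !bnd_simp => /andP[y1 y2] /andP[x1 x2].
  have := Bx i; rewrite sub0r add0r itv_boundlr !bnd_simp -ler_norml => xb.
  have : `|tnth y i| <= `|tnth x i| + 2 * r.
    rewrite (_ : tnth y i = tnth x i + (tnth y i - tnth x i)); last by ring.
    apply: (le_trans (ler_normD _ _)); rewrite lerD2l ler_norml.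
    by apply/andP; split; lra.
  move: hi; rewrite exprD; lra.
have p2 : j.+1%:R <= 2 * (2 ^+ j - 1) :> R by exact: succ_le_exp2.
have jj : 3 <= j.+1%:R :> R by rewrite ler_nat.
have p4 : 2 ^+ 2 <= 2 ^+ j :> R by rewrite ler_weXn2l// ler1n.
rewrite expr2 in p4; set D := 2 ^+ j - 1 in hr p2.
have D1 : 2 <= D by rewrite /D; lra.
have t0 : 0 < 2 ^+ j * expR 1 :> R by rewrite mulr_gt0 ?exprn_gt0 ?expR_gt0.
have qD : q / vol Q <= 2 / D.
  apply: (@le_trans _ _ ((2 / D) ^+ n)).
    rewrite ler_pdivrMr//; apply: (le_trans hB).
    have D0 : 0 <= 2 / D by apply: divr_ge0 => //; lra.
    have g1 : 0 <= 2 * (2 ^+ j * expR 1) :> R by apply: mulr_ge0 => //; exact: ltW.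
    have g2 : 0 <= 2 / D * (2 * r) by apply: mulr_ge0 => //; lra.
    rewrite vQ vol_ccube// -exprMn; apply: lerXn2r; rewrite ?nnegrE//.
    rewrite mulrAC ler_pdivlMr; last lra.
    have : 2 * (2 ^+ j * D * expR 1) <= 2 * (2 * r) by rewrite ler_pM2l.
    lra.
  rewrite -[n]prednK// exprS ler_piMr ?divr_ge0//; first lra.
  by apply: exprn_ile1; [rewrite divr_ge0//; lra|rewrite ler_pdivrMr; lra].
apply: (@le_trans _ _ (2 / D * j.+1%:R)).
  by rewrite ler_wpM2r.
rewrite mulrAC ler_pdivrMr; lra.
Qed.

Section one_weight.
Variable w : Rn R n -> R.
Hypothesis hw : Ap_infty p w.
Local Notation b := (log_Ap Cp p w).
Local Notation rate := (dilate_rate (n:=n) Cp).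
Local Notation N0 := (weight_norm p w cube0).
Local Notation u := (Num.max 0 (ln N0)).
Local Notation W := (modular mu p w).
Local Notation X := (far_scale (n:=n) pmax Cp p w).

(** Q is not contained in the 2j-th cube about the origin, whose norm is smaller. So
    either Q misses the j-th cube, outside which p is close to pinf, or that cube
    fills a proportion at most 4 / (j + 1) of Q. *)
Lemma mean_exponent_far Q (T : R) : cube Q -> X <= T -> ln (weight_norm p w Q) = u + T ->
  `|mean mu Q p - pinf| * T <= 2 * X * Cinf + 4 * pmax * X.
Proof.
move=> cQ hT eT.
have [j [j1 _ hj2 hjT hout]] := far_origin_cube n_gt0 CpP hp hw hT.
have X16 := far_scale_ge n_gt0 CpP hp hw.
have /andP[q1 q2] := LH_pinf_bounds n_gt0 hp; have q3 := LH_pmin_ge1 hp.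
have Ci0 : 0 < Cinf by have [_ [_ [_ _ ?] _ _] _ _] := hp.
have u0 : 0 <= u by rewrite le_max lexx.
have T0 : 0 < T by lra.
have cB := cube_origin_cube (R := R) (n := n) j.
have cB2 := cube_origin_cube (R := R) (n := n) (j + j).
have mQ := cube_measurable cQ; have mB := cube_measurable cB.
have v0 := vol_gt0 cQ.
have hP x : `|p x - pinf| <= pmax.
  have /andP[r1 r2] := LH_bounds n_gt0 hp x.
  by rewrite ler_norml; apply/andP; split; lra.
have hE x : Q x -> ~ origin_cube j x -> `|p x - pinf| <= 2 * X * Cinf / T.
  by move=> _ nB; rewrite ler_pdivlMr//; exact: hout.
have e0 : 0 <= 2 * X * Cinf / T.
  have XC : 0 <= X * Cinf by rewrite mulr_ge0//; lra.
  by apply: divr_ge0; [lra|exact: ltW].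
have := mean_dist_le mQ v0 mB (LH_measurable hp) hP hE e0.
rewrite -/(vol Q) => h.
have [x Qx nBx] : exists2 x, Q x & ~ origin_cube (j + j) x.
  apply: contrapT => h'.
  have sub : Q `<=` origin_cube (j + j).
    by move=> x Qx; apply: contrapT => nB; apply: h'; exists x.
  have [_ /andP[_ hN]] := weight_norm_subset n_gt0 CpP hp hw mQ cB2 sub.
  have [_ N_gt0 _ _ _] := Ap_cube n_gt0 CpP hp hw cQ.
  have := le_ln N_gt0 hN; rewrite eT => h1.
  have pm1 : 1 <= pmax by lra.
  have h2 : T / (2 * pmax) <= T / 2.
    by rewrite ler_wpM2l ?(ltW T0)// lef_pV2 ?posrE//; lra.
  by move: h1 hj2 h2 T0; lra.
have ratio : fine (mu (Q `&` origin_cube j)) / vol Q * j.+1%:R <= 4.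
  have [[y Qy By]|nQB] := pselect (exists2 y, Q y & origin_cube j y).
    exact: (cube_crossing_ratio cQ j1 Qy Qx By nBx).
  have -> : Q `&` origin_cube j = set0.
    by apply/seteqP; split => // y [Qy By]; apply: nQB; exists y.
  by rewrite measure0 mul0r mul0r.
apply: (@le_trans _ _ ((2 * X * Cinf / T + pmax *
    (fine (mu (Q `&` origin_cube j)) / vol Q)) * T)).
  by rewrite ler_wpM2r// ltW.
rewrite mulrDl divfK ?gt_eqF// lerD2l.
set q := _ / _ in ratio *.
have q0 : 0 <= q by rewrite divr_ge0 ?fine_ge0// ltW.
apply: (@le_trans _ _ (pmax * q * (j.+1%:R * X))).
  by rewrite ler_wpM2l// mulr_ge0//; lra.
have -> : pmax * q * (j.+1%:R * X) = pmax * X * (q * j.+1%:R) by ring.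
have -> : 4 * pmax * X = pmax * X * 4 by ring.
by rewrite ler_wpM2l// mulr_ge0//; lra.
Qed.

(** For small and moderate norms N the exponent p may be replaced by its mean because
    (p - mean p) ln N is bounded on Q; for large N both are compared with pinf. *)
Lemma modular_mean_exponent : exists2 K : R, 0 <= K & forall Q, cube Q ->
  (W Q <= (2 * expR (mean mu Q p * ln (weight_norm p w Q) + K))%:E)%E /\
  ((expR (mean mu Q p * ln (weight_norm p w Q) - K) / 2)%:E <= W Q)%E.
Proof.
have X16 := far_scale_ge n_gt0 CpP hp hw.
have /andP[q1 q2] := LH_pinf_bounds n_gt0 hp; have q3 := LH_pmin_ge1 hp.
have Ci0 : 0 < Cinf by have [_ [_ [_ _ ?] _ _] _ _] := hp.
have u0 : 0 <= u by rewrite le_max lexx.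
have b2 := log_Ap_ge2 n_gt0 CpP hp hw.
have rate1 := @dilate_rate_ge1 R n Cp.
pose K1 := rate * b * c1 + c1 * `|ln N0|.
pose K2 := pmax * (u + X).
pose K3 := 2 * X * Cinf + u * pmax + (2 * X * Cinf + 4 * pmax * X + pmax * u).
have K1_ge0 : 0 <= K1 by rewrite addr_ge0// !mulr_ge0//; lra.
have K2_ge0 : 0 <= K2 by rewrite mulr_ge0//; lra.
have XC : 0 <= X * Cinf by rewrite mulr_ge0//; lra.
have pX : 0 <= pmax * X by rewrite mulr_ge0//; lra.
have pu : 0 <= pmax * u by rewrite mulr_ge0//; lra.
have K3_ge0 : 0 <= K3 by rewrite /K3; lra.
exists (K1 + K2 + K3); first lra.
move=> Q cQ; set lN := ln _; set pQ := mean _ _ _.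
have mQ := cube_measurable cQ; have v0 := vol_gt0 cQ.
have [_ N_gt0 _ _ _] := Ap_cube n_gt0 CpP hp hw cQ.
have hM : (1 <= modular mu p (fun x => w x / expR lN)%R Q)%E.
  apply: (rho_weight_norm_ge1 n_gt0 CpP hp hw cQ mQ (fun=> id) (expR_gt0 _)).
  by rewrite /lN (lnK N_gt0); exact: lexx.
have concl K : K <= K1 + K2 + K3 -> (forall x, Q x -> `|(p x - pQ) * lN| <= K) ->
    (W Q <= (2 * expR (pQ * lN + (K1 + K2 + K3)))%:E)%E /\
    ((expR (pQ * lN - (K1 + K2 + K3)) / 2)%:E <= W Q)%E.
  move=> KK h; split.
    apply: (W_le_of_exponent n_gt0 CpP hp hw cQ erefl) => x Qx; rewrite -/lN.
    by have := h x Qx; rewrite ler_norml => /andP[]; lra.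
  apply: (W_ge_of_exponent hp hw mQ hM) => x Qx.
  by have := h x Qx; rewrite ler_norml => /andP[]; lra.
have mdist e : 0 <= e -> (forall x y, Q x -> Q y -> `|p x - p y| <= e) ->
    forall x, Q x -> `|p x - pQ| <= e.
  move=> e0 h x Qx; rewrite distrC.
  have hP y : `|p y - p x| <= pmax by exact: (LH_osc_le n_gt0 hp).
  have hE y : Q y -> ~ set0 y -> `|p y - p x| <= e by move=> Qy _; exact: h.
  have := mean_dist_le mQ v0 measurable0 (LH_measurable hp) hP hE e0.
  by rewrite setI0 measure0 mul0r mulr0 addr0.
have [lN0|lN0] := leP lN 0.
  have [k k1 [hk hko]] := small_norm_osc n_gt0 CpP hp hw hosc cQ.
  apply: (concl K1); first lra.
  have k0 : 0 < k by lra.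
  have hd : forall x, Q x -> `|p x - pQ| <= c1 / k.
    apply: mdist; first by rewrite divr_ge0// ltW.
    by move=> x y Qx Qy; rewrite ler_pdivlMr//; exact: hko.
  move=> x Qx; rewrite normrM (ler0_norm lN0).
  apply: (@le_trans _ _ (c1 / k * (rate * b * k + `|ln N0|))).
    by apply: ler_pM => //; [rewrite oppr_ge0|exact: hd].
  rewrite mulrDr; apply: lerD.
    by rewrite mulrCA divfK ?gt_eqF.
  by rewrite ler_wpM2r// ler_pdivrMr// ler_peMr.
have [cb|cb] := leP lN (u + X).
  apply: (concl K2); first lra.
  have hd : forall x, Q x -> `|p x - pQ| <= pmax.
    by apply: mdist; [lra|move=> x y _ _; exact: (LH_osc_le n_gt0 hp)].
  move=> x Qx; rewrite normrM (gtr0_norm lN0).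
  by apply: ler_pM => //; [exact: ltW|exact: hd].
have hT : X <= lN - u by lra.
have eT : lN = u + (lN - u) by ring.
have far := mean_exponent_far cQ hT eT; rewrite -/pQ in far.
have pQb : `|pQ - pinf| <= pmax.
  have hP y : `|p y - pinf| <= pmax.
    have /andP[r1 r2] := LH_bounds n_gt0 hp y.
    by rewrite ler_norml; apply/andP; split; lra.
  have hE y : Q y -> ~ set0 y -> `|p y - pinf| <= pmax by move=> _ _; exact: hP.
  have pm0 : 0 <= pmax by lra.
  have := mean_dist_le mQ v0 measurable0 (LH_measurable hp) hP hE pm0.
  by rewrite setI0 measure0 mul0r mulr0 addr0.
have diff : `|(pQ - pinf) * lN| <= 2 * X * Cinf + 4 * pmax * X + pmax * u.
  rewrite normrM (gtr0_norm lN0) {1}eT mulrDr addrC; apply: lerD => //.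
  by rewrite ler_wpM2r.
have hle := W_le_far n_gt0 CpP hp hw cQ hT eT.
rewrite {1}eT in hM.
have hge := W_ge_far n_gt0 CpP hp hw mQ hT hM.
rewrite -eT in hle; rewrite -eT in hge.
have up1 : u * (pmax - pinf) <= u * pmax by rewrite ler_wpM2l//; lra.
have up2 : u * (pinf - pmin) <= u * pmax by rewrite ler_wpM2l//; lra.
move: diff; rewrite ler_norml => /andP[d1 d2].
split.
  apply: (le_trans hle); rewrite lee_fin ler_pM2l// ler_expR.
  by rewrite /K3; lra.
apply: le_trans hge; rewrite lee_fin ler_pM2r ?invr_gt0// ler_expR.
by rewrite /K3; lra.
Qed.

End one_weight.

End modular_mean_exponent.

(** * The weight w ^ p belongs to A_oo *)

Lemma measurable_power_weight d (T : measurableType d) (R : realType) (p w : T -> R) :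
  measurable_fun setT p -> measurable_fun setT w ->
  measurable_fun setT (fun x => w x `^ p x)%R.
Proof. by move=> mp mw; apply: measurable_powR_fun. Qed.

Section power_weight.
Context {R : realType} {n : nat}.
Hypothesis n_gt0 : (0 < n)%N.
Local Notation mu := (@leb R n).
Implicit Types (Q S : set (Rn R n)) (c : 'I_n -> R) (r : R).
Variables (pmin pmax pinf C0 Cinf Cp : R).
Hypothesis CpP : @average_norm_constant R n pmin pmax pinf C0 Cinf Cp.
Variable p : Rn R n -> R.
Hypothesis hp : LH_exponent pmin pmax pinf C0 Cinf p.
Local Open Scope ring_scope.

Variable c1 : R.
Hypothesis c1_ge0 : 0 <= c1.
Hypothesis hosc : forall (c : 'I_n -> R) r, 0 < r -> exists k : nat,
  cube0 `<=` ccube c (2 ^+ k * r) /\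
  forall x y, ccube c r x -> ccube c r y -> `|p x - p y| * k.+1%:R <= c1.

Local Notation one := (fun _ : Rn R n => 1 : R).

Lemma one_mul_indic Q : one \* \1_Q = \1_Q :> (Rn R n -> R).
Proof. by apply/funext => x /=; rewrite mul1r. Qed.

Lemma Ap_infty_one : Ap_infty p one.
Proof.
split.
  split; [exact: measurable_cst|by move=> x; exact: ler01|].
  by apply: aeW => x; exact: ltr01.
apply: (@le_lt_trans _ _ 1%E); last exact: ltry.
apply: ge_ereal_sup => _ [Q cQ <-].
have [L0 eL] := indic_norm_fin n_gt0 hp cQ.
rewrite one_mul_indic eL inver (gt_eqF L0) -EFinM mulVf ?(gt_eqF L0)//.
rewrite /exp_average_log_inv (average_mean _ cQ).
rewrite (eq_integral (fun=> 0%E)); last by move=> x _; rewrite invr1 ln1.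
by rewrite integral0 mule0 /= expR0 mul_infty_EFin mulr1.
Qed.

Lemma weight_norm_one Q : weight_norm p one Q = indic_norm p Q.
Proof. by rewrite weight_norm.unlock indic_norm.unlock one_mul_indic. Qed.

Lemma modular_one Q : cube Q -> modular mu p one Q = (vol Q)%:E.
Proof.
move=> cQ; rewrite /modular.
rewrite (eq_integral (cst 1%E)); last by move=> x _; rewrite powR1.
by rewrite (integral_cst mu (cube_measurable cQ)) mul1e (cube_mu cQ).
Qed.

Variable w : Rn R n -> R.
Hypothesis hw : Ap_infty p w.
Local Notation wA := (fine (Ap_infty_const p w)).
Local Notation b := (log_Ap Cp p w).
Local Notation W := (fun x => w x `^ p x).

Let mw : measurable_fun setT w. Proof. by have [[? _ _] _] := hw. Qed.
Let w0 : forall x, 0 <= w x. Proof. by have [[_ ? _] _] := hw. Qed.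
Let wpos : {ae mu, forall x, (0 < w x)%R}. Proof. by have [[_ _ ?] _] := hw. Qed.

(** ln W = p ln w, and on average over Q the function ln w is within a bounded
    distance of ln (N_Q / L_Q), with N_Q and L_Q the norms of w 1_Q and 1_Q. *)
Lemma lnmean_power_ge Q : cube Q ->
  mu.-integrable Q (EFin \o (fun x => ln (W x))) /\
  mean mu Q p * (ln (weight_norm p w Q) - ln (indic_norm p Q)) - pmax * (`|ln wA| + 2 * b) <=
    lnmean W Q.
Proof.
move=> cQ; have mQ := cube_measurable cQ; have v0 := vol_gt0 cQ.
have [_ N_gt0 [iw iL] _ hN] := Ap_cube n_gt0 CpP hp hw cQ.
have [L0 _] := indic_norm_fin n_gt0 hp cQ.
have A0 := Ap_const_gt0 n_gt0 CpP hp hw.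
have b2 := log_Ap_ge2 n_gt0 CpP hp hw.
have [a ha] := ln_mean_osc n_gt0 CpP hp hw cQ.
have p01 x : 0 <= p x <= pmax.
  by have /andP[h1 ->] := LH_range n_gt0 hp x; rewrite andbT; lra.
have [iW hW] := mean_weighted_ge mQ v0 iL a (LH_measurable hp) p01.
have eW : (fun x => ln (W x)) = (fun x => p x * ln (w x)).
  by apply/funext => x; rewrite ln_powR.
split; first by rewrite eW.
rewrite /lnmean eW; apply: le_trans hW.
have pm1 := LH_pmax_ge1 n_gt0 hp.
have hga : `|lnmean w Q - a| <= b.
  have := mean_subset mQ v0 iL a mQ (fun=> id) v0.
  rewrite -/(vol Q) divff ?gt_eqF// mul1r => h; exact: le_trans h ha.
have hlN : ln (weight_norm p w Q) <= ln wA + ln (indic_norm p Q) + lnmean w Q.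
  have e0 : 0 < expR (lnmean w Q) by exact: expR_gt0.
  have := le_ln N_gt0 hN.
  by rewrite lnM ?posrE ?mulr_gt0// lnM ?posrE// expRK.
have hpQ : 0 <= mean mu Q p <= pmax.
  have ip : mu.-integrable Q (EFin \o p).
    have iP := intble_cst mQ v0 pmax.
    apply: (le_integrable mQ _ _ iP).
      apply/measurable_EFinP; exact: measurable_funS (LH_measurable hp).
    move=> x _; rewrite /= lee_fin; have /andP[h1 h2] := p01 x.
    by rewrite (ger0_norm h1) ger0_norm//; lra.
  apply/andP; split.
    rewrite -(mean_cst mQ v0 0); apply: (le_mean mQ v0 (intble_cst mQ v0 0) ip).
    by move=> x _; have /andP[] := p01 x.
  rewrite -(mean_cst mQ v0 pmax); apply: (le_mean mQ v0 ip (intble_cst mQ v0 pmax)).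
  by move=> x _; have /andP[] := p01 x.
have hlA : ln wA <= `|ln wA| by exact: ler_norm.
have nA : 0 <= `|ln wA| by [].
move: hga hlN ha hpQ; rewrite ler_norml => /andP[g1 g2].
move: (ln (weight_norm p w Q)) (ln (indic_norm p Q)) (ln wA) `|ln wA| (lnmean w Q) (mean mu Q p)
  (mean mu Q _) b g1 g2 hlA nA b2.
move=> lN lL lA nlA g pQ osc b' g1 g2 hlA nA b2 hlN ha /andP[h1 h2].
have e1 : pQ * (lN - lL) <= pQ * (a + nlA + b') by rewrite ler_wpM2l//; lra.
have e2 : pQ * (nlA + b') <= pmax * (nlA + b') by rewrite ler_wpM2r//; lra.
have e3 : pmax * osc <= pmax * b' by rewrite ler_wpM2l//; lra.
lra.
Qed.

(** [modular_mean_exponent] for w and for the weight 1 bounds the average of W over Q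
    by a multiple of the power of exponent mean p of N_Q / L_Q; [lnmean_power_ge] bounds
    the geometric mean of W below by a multiple of the same power. *)
Lemma A_infty_power : A_infty W.
Proof.
split.
  split.
  - exact: (measurable_power_weight (LH_measurable hp) mw).
  - by move=> x; exact: powR_ge0.
  - by apply: filterS wpos => x; exact: powR_gt0.
have [K K0 hK] := modular_mean_exponent n_gt0 CpP hp c1_ge0 hosc hw.
have [K' K0' hK'] := modular_mean_exponent n_gt0 CpP hp c1_ge0 hosc Ap_infty_one.
apply: (@le_lt_trans _ _ (4 * expR (K + K' + pmax * (`|ln wA| + 2 * b)))%:E); last exact: ltry.
apply: ge_ereal_sup => _ [Q cQ <-].
have mQ := cube_measurable cQ; have v0 := vol_gt0 cQ.
have [iW hW] := lnmean_power_ge cQ.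
have [h1 _] := hK Q cQ; have [_ h2] := hK' Q cQ.
rewrite weight_norm_one (modular_one cQ) lee_fin in h2.
have mWQ : measurable_fun Q W.
  apply: measurable_funS (measurable_power_weight (LH_measurable hp) mw) => //.
have iWQ : mu.-integrable Q (EFin \o W).
  apply: (integrable_ge0_lty mWQ); first by move=> x _; exact: powR_ge0.
  exact: le_lt_trans h1 (ltry _).
rewrite (A_infty_quotient cQ iWQ iW) lee_fin.
have hm : mean mu Q W <= 2 * expR (mean mu Q p * ln (weight_norm p w Q) + K) / vol Q.
  rewrite /mean ler_wpM2r ?invr_ge0 ?(ltW v0)//.
  by apply: fine_le_EFin h1; exact: modular_ge0.
set pQ := mean mu Q p in hm hW h2; set lN := ln (weight_norm p w Q) in hm hW.
set lL := ln (indic_norm p Q) in h2 hW; set V := vol Q in v0 hm h2.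
set Z := pmax * _ in hW *.
have hm2 : mean mu Q W <= 4 * expR (pQ * lN + K - (pQ * lL - K')).
  apply: (le_trans hm); rewrite ler_pdivrMr//.
  have -> : 2 * expR (pQ * lN + K) =
     4 * expR (pQ * lN + K - (pQ * lL - K')) * (expR (pQ * lL - K') / 2).
    rewrite [in RHS]expRB; field; exact: lt0r_neq0 (expR_gt0 _).
  by rewrite ler_pM2l// mulr_gt0// expR_gt0.
apply: (@le_trans _ _ (4 * expR (pQ * lN + K - (pQ * lL - K')) * expR (- lnmean W Q))).
  by rewrite ler_wpM2r// expR_ge0.
rewrite -mulrA -expRD ler_pM2l// ler_expR; lra.
Qed.

End power_weight.

(** * Admissible alpha and the choice of constants *)

Lemma powR_exp (R : realType) (x q : R) : (0 < x)%R -> (x `^ q = expR (q * ln x))%R.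
Proof. by move=> x0; rewrite /powR (gt_eqF x0). Qed.

(** The admissible range of alpha is exactly where the factor
    1 - 2 alpha ^ (1 - 1/delta) is positive. *)
Lemma alpha_factor (R : realType) (alpha delta : R) : (1 < delta)%R ->
  (0 < alpha < 2 `^ (- (delta / (delta - 1))))%R ->
  (0 < 1 - 2 * alpha `^ (1 - delta^-1) <= 1)%R.
Proof.
move=> d1 /andP[a0 a1]; have d0 : (0 < delta)%R by lra.
have q0 : (0 < 1 - delta^-1)%R by rewrite subr_gt0 invf_lt1.
have h : (alpha `^ (1 - delta^-1) < 2^-1)%R.
  have -> : (2^-1 = (2 `^ (- (delta / (delta - 1)))) `^ (1 - delta^-1) :> R)%R.
    rewrite -powRrM (_ : - (delta / (delta - 1)) * (1 - delta^-1) = - 1)%R.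
      by rewrite powR_inv1.
    by field; rewrite gt_eqF//= subr_eq0 gt_eqF.
  by apply: gt0_ltr_powR => //; rewrite nnegrE ?powR_ge0// ltW.
have := powR_ge0 alpha (1 - delta^-1); move: h; set t := (_ `^ _)%R => h t0.
by apply/andP; split; lra.
Qed.

Lemma exp_le_max_powR (R : realType) (x s D : R) : (0 < x)%R -> (0 <= s <= D)%R ->
  (expR (s * `|ln x|) <= Num.max (x `^ (- D)) (x `^ D))%R.
Proof.
move=> x0 /andP[s0 sD]; rewrite !powR_exp// le_max !ler_expR.
have [l0|l0] := leP 0%R (ln x).
  by rewrite ger0_norm// [X in _ || X]ler_wpM2r// orbT.
by rewrite ltr0_norm// mulNr -mulrN [X in X || _]ler_wpM2r// oppr_ge0 ltW.
Qed.

Lemma lte_of_exp_bounds (R : realType) (x y : \bar R) (a1 a2 K : R) :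
  x <= (2 * expR a2)%:E -> (expR a1 / 2)%:E <= y -> (4 * expR (a2 - a1) < K)%R ->
  x < K%:E * y.
Proof.
move=> hx hy hK; have e1 := expR_gt0 a1; have e2 := expR_gt0 (a2 - a1).
apply: (@lt_le_trans _ _ (K%:E * (expR a1 / 2)%:E)); last first.
  by apply: lee_wpmul2l => //; rewrite lee_fin; lra.
apply: (le_lt_trans hx); rewrite -EFinM lte_fin.
have -> : (2 * expR a2 = 4 * expR (a2 - a1) * (expR a1 / 2))%R.
  by rewrite expRB; field; rewrite gt_eqF.
by rewrite ltr_pM2r//; lra.
Qed.

Unset Implicit Arguments.
Set Strict Implicit.

Theorem proposition2p15 (R : realType) (n : nat) (n_gt0 : (0 < n)%N)
  (tau : R) (tauP : @reverse_holder_constant R n tau)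
  (pmin pmax pinf C0 Cinf Cp : R)
  (CpP : @average_norm_constant R n pmin pmax pinf C0 Cinf Cp) :
  exists C A : R, (0 < C)%R /\ (0 < A)%R /\
    forall p : Rn R n -> R, LH_exponent pmin pmax pinf C0 Cinf p ->
    forall w : Rn R n -> R, Ap_infty p w ->
    let W : Rn R n -> R := fun x => (w x `^ p x)%R in
    let wA : R := fine (Ap_infty_const p w) in
    let delta : R := (1 + (tau * Cp * wA)^-1)%R in
    let N0 : R := fine (Lpnorm p (w \* \1_cube0)%R) in
    let Lw : R := Num.max (N0 `^ (pmin - pmax))%R (N0 `^ (pmax - pmin))%R in
    A_infty W /\
    forall alpha : R, (0 < alpha < 2 `^ (- (delta / (delta - 1))))%R ->
    forall Q E : set (Rn R n), cube Q -> measurable E -> E `<=` Q ->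
      (1 - alpha)%:E * leb R n Q < leb R n E ->
      \int[leb R n]_(x in Q) (W x)%:E <
        (C * (1 - 2 * alpha `^ (1 - delta^-1)) `^ (- pmax) * wA `^ A * Lw)%:E
          * \int[leb R n]_(x in E) (W x)%:E.
Proof.
have [[p0 hp0]|nex] := pselect (exists p : Rn R n -> R,
    LH_exponent pmin pmax pinf C0 Cinf p); last first.
  exists 1%R, 1%R; split; [exact: ltr01|split; [exact: ltr01|]] => p hp.
  by exfalso; apply: nex; exists p.
have [c1 c1_ge0 osc] := osc_chain n_gt0 pmin pmax pinf C0 Cinf.
pose B := compare_cst (n := n) pmin pmax Cinf Cp c1.
have pm1 := LH_pmax_ge1 n_gt0 hp0; have Cp0 := Cp_gt0 CpP.
have Ci0 : (0 < Cinf)%R by have [_ [_ [_ _ ?] _ _] _ _] := hp0.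
have pmm : (0 <= pmax - pmin)%R.
  by have /andP[q1 q2] := LH_pinf_bounds n_gt0 hp0; rewrite subr_ge0 (le_trans q1).
have B0 : (0 <= B)%R.
  have r1 := @dilate_rate_ge1 R n Cp.
  rewrite /B /compare_cst; apply: addr_ge0; apply: mulr_ge0 => //.
  - exact: le_trans ler01 r1.
  - by apply: mulr_ge0; [lra|exact: le_trans ler01 r1].
  - by lra.
exists (8 * expR (2 * B + (B + pmax) * ln Cp))%R, (B + pmax)%R.
split; first by rewrite mulr_gt0// expR_gt0.
split; first lra.
move=> p hp w hw W wA delta N0 Lw.
have hosc := osc p hp.
split; first exact: (A_infty_power n_gt0 CpP hp c1_ge0 hosc hw).
move=> alpha ha Q E cQ mE EQ hE.
have A0 : (0 < wA)%R := Ap_const_gt0 n_gt0 CpP hp hw.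
have A1 : (1 <= Cp * wA)%R := Ap_const_ge1 n_gt0 CpP hp hw.
have [tau0 _] := tauP.
have d1 : (1 < delta)%R by rewrite /delta ltrDl invr_gt0 !mulr_gt0.
have /andP[eta0 eta1] := alpha_factor d1 ha.
have a0 : (0 < alpha)%R by have /andP[] := ha.
have := weight_norm_large_subset n_gt0 tauP CpP hp hw cQ mE EQ a0 hE.
rewrite -/wA -/delta; set eta := (1 - _)%R in eta0 eta1 * => hN.
pose lD : R := (ln (Cp * wA) - ln eta)%R.
have CA0 : (0 < Cp * wA)%R by exact: mulr_gt0.
have lD0 : (0 <= lD)%R.
  by rewrite subr_ge0; exact: (le_trans (ln_le0 eta1) (ln_ge0 A1)).
have hND : (weight_norm p w Q <= expR lD * weight_norm p w E)%R.
  by rewrite expRB (lnK CA0) (lnK eta0) mulrAC ler_pdivlMr// mulrC.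
have [a1 [a2 [s [hs hQ hE' hd]]]] :=
  W_compare n_gt0 CpP hp hw c1_ge0 hosc cQ mE EQ lD0 hND.
apply: (lte_of_exp_bounds hQ hE').
have eN0 : N0 = weight_norm p w cube0 by rewrite weight_norm.unlock.
have [_ N0_gt0 _ _ _] := Ap_cube n_gt0 CpP hp hw (cube_cube0 (R := R) (n := n)).
have hL : (expR (s * `|ln N0|) <= Lw)%R.
  rewrite /Lw -[(pmin - pmax)%R]opprB; apply: exp_le_max_powR => //.
  by rewrite eN0.
rewrite -eN0 -/B /log_Ap -/wA in hd.
rewrite (powR_exp _ eta0) (powR_exp _ A0).
apply: (@lt_le_trans _ _ (8 * expR (2 * B + (B + pmax) * ln Cp) *
  expR (- pmax * ln eta) * expR ((B + pmax) * ln wA) * expR (s * `|ln N0|))%R); last first.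
  by rewrite ler_pM2l// !mulr_gt0// expR_gt0.
rewrite -!mulrA -!expRD.
apply: (@le_lt_trans _ _ (4 * expR (2 * B + (B + pmax) * ln Cp +
   (- pmax * ln eta + ((B + pmax) * ln wA + s * `|ln N0|))))%R); last first.
  by rewrite ltr_pM2r ?expR_gt0// ltr_nat.
rewrite ler_pM2l// ler_expR; apply: (le_trans hd).
by rewrite /lD [ln (Cp * wA)]lnM ?posrE//; lra.
Qed.
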